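(* Let $K_n$ denote the Bohr radius of the $n$-dimensional polydisk. Then $K_n\sim\sqrt{(\log n)/n}$ as $n\to+\infty$, that is, $$\lim_{n\to+\infty}\frac{K_n}{\sqrt{\frac{\log n}{n}}}=1.$$
   Context: $\mathbb D$ is the open unit disk of $\mathbb C$. For $n\ge 1$, the Bohr radius $K_n$ of the polydisk $\mathbb D^n$ is the largest positive number $r$ such that all (complex) polynomials $\sum_\alpha a_\alpha z^\alpha$ on $\mathbb C^n$ (finite sums over multi-indices $\alpha\in\mathbb N_0^n$, with $z^\alpha=z_1^{\alpha_1}\cdots z_n^{\alpha_n}$) satisfy $$\sup_{z\in r\mathbb D^n}\sum_\alpha|a_\alpha z^\alpha|\le\sup_{z\in\mathbb D^n}\Big|\sum_\alpha a_\alpha z^\alpha\Big|.$$ *)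

(* Defs.v *)
From HB Require Import structures.
From mathcomp Require Import all_boot all_order all_algebra.
From mathcomp Require Import all_classical all_reals all_analysis.
From mathcomp Require Import complex.
(* Not imported: its notations clash with those of the analysis library. *)
From mathcomp Require mpoly.

Set Implicit Arguments.
Unset Strict Implicit.
Unset Printing Implicit Defensive.

Import Order.TTheory GRing.Theory Num.Theory.
Import numFieldNormedType.Exports.

Local Open Scope classical_set_scope.
Local Open Scope ring_scope.

(* For 0 < r, this is r D^n with D the open unit disk of the complex plane. *)
Definition polydisk (R : realType) (n : nat) (r : R) : set ('I_n -> complex R) :=
  [set z | forall i, Normc.normc (z i) < r].
Arguments polydisk {R} n r.

(* Sum of |a_alpha z^alpha|, where a_alpha are the coefficients of p. *)
Definition majorant (R : realType) (n : nat) (p : mpoly.mpoly n (complex R))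
    (z : 'I_n -> complex R) : R :=
  \sum_(a <- mpoly.msupp p)
    Normc.normc (mpoly.mcoeff a p *
      \prod_(i < n) z i ^+ mpoly.fun_of_multinom a i).

Definition bohr_inequality (R : realType) (n : nat) (r : R) : Prop :=
  forall p : mpoly.mpoly n (complex R),
    (ereal_sup [set (majorant p z)%:E | z in polydisk n r] <=
     ereal_sup [set (Normc.normc (mpoly.meval z p))%:E
               | z in polydisk n (1 : R)])%E.

Definition bohr_set (R : realType) (n : nat) : set R :=
  [set r | 0 < r /\ bohr_inequality n r].
Arguments bohr_set R n : clear implicits.

(* The greatest element of [bohr_set R n]. The default value 0 of [xget]
   would be returned only if there were none, as happens for n = 0; no
   element of [bohr_set R n] is equal to it. *)
Definition bohr_radius (R : realType) (n : nat) : R :=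
  xget 0 (bohr_set R n `&` ubound (bohr_set R n)).
Arguments bohr_radius R n : clear implicits.

(* Main.v *)
From HB Require Import structures.
Require Import Defs.
From mathcomp Require Import all_boot all_order all_algebra.
From mathcomp Require Import all_classical all_reals all_analysis.
From mathcomp Require Import complex perm separable cyclic cyclotomic.
From mathcomp Require Import ring lra zify.
From mathcomp Require mpoly.
Import -(notations) mpoly.

(** The lower bound for the Bohr radius comes from an estimate of the sum of
    the moduli of the coefficients of a homogeneous polynomial P of degree d
    that is bounded by B on the polydisk. Single out k + 1 of the d arguments
    of the symmetric d-linear form of P, let z be the common value of the
    other l = d - k - 1, and let f_i(z) be the entries of the resulting
    (k+1)-linear form. Hoelder's inequality between the exponents
    2(k+1)/(k+2), 2 and 4 compares the L^2 norm of f_i with its L^p norm for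
    p = 2(k+1)/(k+2), with a constant 2^(l/(k+1)) ([form_hyper]); as k grows
    this is (1+o(1))^d. For fixed z Blei's inequality ([blei]) bounds the
    l^p norm of the family f_i(z) by mixed norms, and these by B up to a
    factor polynomial in d ([polarization], [mixed_norm]). The Cauchy-Schwarz
    inequality over the monomials of degree l then gives
    [coefficient_sum]: the sum of the moduli of the coefficients is at most
    C_k d^(k+1) 2^(l/(k+1)) n^(k/2) B times the square root of the number
    of these monomials, which is about (e n / l)^l. Multiplied by r^d with
    r = rho sqrt (log n / n) and rho < 1, this is at most a small multiple of
    th^d B for some th < 1 ([geometric_terms], [count_factor_small]): the
    worst degrees are close to log n, where n^(-1/2) makes up for e^(d/2).
    By Wiener's inequality the homogeneous parts of positive degree of a
    polynomial bounded by B are bounded by 2 (B - |a_0|), so that Bohr's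
    inequality follows by summation over d ([wiener], [bohr_criterion],
    [bohr_lower]).

    The upper bound tests the inequality on a form of degree m with
    coefficients +-(m! / alpha!), whose sum of moduli at (r, ..., r) is
    (n r)^m. Suitable signs make its supremum at most a polynomial in m times
    sqrt (n m! n^m) ([good_signs], [small_signed_form]). With m just above
    log n, the factor n^(1/m) is close to e and cancels the e in
    (m!)^(1/m), close to m/e ([bohr_upper]).

    A homogeneous polynomial of degree m is represented as phi (l(z)^m), where
    phi is a linear functional on a commutative algebra with elements X_a and
    l(z) is the sum of the z_a X_a. Its symmetric tensor consists of the
    values of phi on products of the X_a, its polar forms are the values of
    phi on products of linear forms, and multinomial expansions take place in
    the algebra. Integrals over the torus are replaced by means over roots of
    unity of large order, which are exact on the polynomials concerned. *)

Set Implicit Arguments.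
Unset Strict Implicit.
Unset Printing Implicit Defensive.

Import Order.TTheory GRing.Theory Num.Theory.
Import numFieldNormedType.Exports.

Local Open Scope ring_scope.
Local Notation cn := Normc.normc.
Local Notation Re := complex.Re.
Local Notation Im := complex.Im.

(** * Complex moduli and roots of unity *)

Section Modulus.
Variable R : realType.
Implicit Types z w : complex R.

Lemma cn_norm z : `|z| = (cn z)%:C%C. Proof. by []. Qed.

Lemma cn_ge0 z : 0 <= cn z.
Proof. by case: z => a b; exact: sqrtr_ge0. Qed.

Lemma cn0 : cn (0 : complex R) = 0. Proof. exact: Normc.normc0. Qed.
Lemma cn1 : cn (1 : complex R) = 1. Proof. exact: Normc.normc1. Qed.
Lemma cnM z w : cn (z * w) = cn z * cn w. Proof. exact: Normc.normcM. Qed.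
Lemma cnV z : cn z^-1 = (cn z)^-1. Proof. exact: Normc.normcV. Qed.

Lemma cnD z w : cn (z + w) <= cn z + cn w.
Proof. by rewrite -lecR rmorphD -!cn_norm ler_normD. Qed.

Lemma cnN z : cn (- z) = cn z.
Proof. by case: z => a b /=; rewrite !sqrrN. Qed.

Lemma cnJ z : cn (conjc z) = cn z.
Proof. by case: z => a b /=; rewrite sqrrN. Qed.

Lemma cnX z n : cn (z ^+ n) = cn z ^+ n.
Proof. by elim: n => [|n IH]; rewrite ?expr0 ?cn1// !exprS cnM IH. Qed.

Lemma cn_prod (I : Type) (s : seq I) (P : pred I) (F : I -> complex R) :
  cn (\prod_(i <- s | P i) F i) = \prod_(i <- s | P i) cn (F i).
Proof. by apply: (big_morph _ cnM cn1). Qed.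

Lemma cn_sum (I : Type) (s : seq I) (P : pred I) (F : I -> complex R) :
  cn (\sum_(i <- s | P i) F i) <= \sum_(i <- s | P i) cn (F i).
Proof.
elim/big_rec2: _ => [|i y x _ h]; first by rewrite cn0.
by apply: le_trans (cnD _ _) _; rewrite lerD2l.
Qed.

Lemma cn_real (x : R) : cn x%:C%C = `|x|.
Proof. by rewrite /= expr0n addr0 sqrtr_sqr. Qed.

Lemma cn_nat n : cn (n%:R : complex R) = n%:R.
Proof. by rewrite -(rmorph_nat (real_complex R)) cn_real ger0_norm. Qed.

Lemma cn_eq0 z : (cn z == 0) = (z == 0).
Proof.
by apply/eqP/eqP => [/Normc.eq0_normc//|->]; rewrite cn0.
Qed.

Lemma cn_sqr z : ((cn z) ^+ 2)%:C%C = z * conjc z.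
Proof.
rewrite [RHS]mulrC -normCKC.
by rewrite cn_norm rmorphXn.
Qed.

Lemma Re_le_cn z : Re z <= cn z.
Proof.
case: z => a b /=; apply: le_trans (ler_norm _) _.
by rewrite -sqrtr_sqr ler_wsqrtr// lerDl sqr_ge0.
Qed.

Lemma cn_le_ReIm z : cn z <= `|Re z| + `|Im z|.
Proof.
case: z => a b /=.
rewrite -(@ler_pXn2r _ 2) ?nnegrE ?sqrtr_ge0 ?addr_ge0//.
rewrite sqr_sqrtr ?addr_ge0 ?sqr_ge0// sqrrD !real_normK ?num_real//.
by rewrite addrAC lerDl mulrn_wge0// mulr_ge0.
Qed.

Lemma ReJ z : z + conjc z = (2 * Re z)%:C%C.
Proof. by case: z => a b /=; apply/eqP; rewrite eq_complex /= subrr mulr_natl mulr2n !eqxx. Qed.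

(** Makes a sum of moduli a single value of a linear expression in
    unimodular unknowns. *)
Lemma phaseE z : {u : complex R | cn u = 1 & u * z = (cn z)%:C%C}.
Proof.
have [->|z0] := eqVneq z 0; first by exists 1; rewrite ?cn1// mulr0 cn0.
exists ((cn z)%:C%C / z).
  by rewrite cnM cnV cn_real ger0_norm ?cn_ge0// divff// cn_eq0.
by rewrite divfK.
Qed.

End Modulus.

Section RootsOfUnity.
Variable R : realType.
Local Notation C := (complex R).

Lemma prim_root_exists N : (0 < N)%N -> {w : C | N.-primitive_root w}.
Proof.
move=> N0; pose p : {poly C} := 'X^N - 1.
have [r Dp] := closed_field_poly_normal p; apply/sigW.
rewrite (monicP _) ?monicXnsubC // scale1r in Dp.
have rn1 : all N.-unity_root r by apply/allP=> z; rewrite -root_prod_XsubC -Dp.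
have sr : (N < (size r).+1)%N.
  by rewrite -(size_prod_XsubC r id) -Dp size_XnsubC.
have [|w] := hasP (has_prim_root N0 rn1 _ sr); last by exists w.
by rewrite -separable_prod_XsubC -Dp separable_Xn_sub_1 // pnatr_eq0 -lt0n.
Qed.

Lemma prim_cn N (w : C) : N.-primitive_root w -> cn w = 1.
Proof.
move=> pw; have N0 := prim_order_gt0 pw.
have : cn w ^+ N = 1 by rewrite -cnX prim_expr_order ?cn1.
by move/eqP; rewrite pexpr_eq1 ?cn_ge0 // => /eqP.
Qed.

Lemma unit_conj (w : C) : cn w = 1 -> conjc w = w^-1.
Proof.
move=> w1; have := cn_sqr w; rewrite w1 expr1n => h.
have w0 : w != 0 by rewrite -cn_eq0 w1 oner_eq0.
by apply: (mulfI w0); rewrite -h divff.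
Qed.

Lemma conjcX (w : C) k : conjc (w ^+ k) = conjc w ^+ k.
Proof. exact: rmorphXn. Qed.

(** For distinct exponents below N the sum is geometric, with a ratio
    that is an N-th root of unity other than 1. *)
Lemma root_orth N (w : C) (a b : nat) : N.-primitive_root w ->
  (a < N)%N -> (b < N)%N ->
  \sum_(j < N) w ^+ (j * a) * conjc (w ^+ (j * b)) = (N * (a == b))%:R.
Proof.
move=> pw aN bN; have w1 := prim_cn pw.
have w0 : w != 0 by rewrite -cn_eq0 w1 oner_eq0.
have E (j : 'I_N) : w ^+ (j * a) * conjc (w ^+ (j * b)) = (w ^+ a / w ^+ b) ^+ j.
  by rewrite conjcX (unit_conj w1) exprMn !exprVn -!exprM ![(_ * j)%N]mulnC.
rewrite (eq_bigr _ (fun j _ => E j)).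
have [->|ab] := eqVneq a b.
  rewrite divff ?expf_neq0// (eq_bigr (fun=> 1)) => [|j _]; last by rewrite expr1n.
  by rewrite sumr_const card_ord muln1.
rewrite muln0; set q := w ^+ a / _.
have q1 : q != 1.
  rewrite /q -subr_eq0 -(mulIr_eq0 _ (mulIf (expf_neq0 b w0))).
  rewrite mulrBl divfK ?expf_neq0// mul1r subr_eq0 (eq_prim_root_expr pw).
  by rewrite !modn_small.
apply: (mulfI (x := q - 1)); first by rewrite subr_eq0.
rewrite mulr0 -subrX1 /q exprMn exprVn -!exprM ![(_ * N)%N]mulnC !exprM.
by rewrite !(prim_expr_order pw) !expr1n invr1 mulr1 subrr.
Qed.

End RootsOfUnity.

(** * Hoelder's and Blei's inequalities *)

Section Holder.
Variable R : realType.

Lemma root_exists (K : nat) (x : R) : (0 < K)%N -> 0 <= x ->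
  {y : R | 0 <= y & y ^+ K = x}.
Proof.
move=> K0 x0; exists (x `^ K%:R^-1); first exact: powR_ge0.
by rewrite -powR_mulrn ?powR_ge0// -powRrM mulVf ?pnatr_eq0 -?lt0n// powRr1.
Qed.

(** After the sums of the g_j are normalised to 1, this is the inequality
    between the geometric and the arithmetic mean at every x, summed over x.
    A hypothesis on the K-th power of h avoids roots of functions. *)
Lemma holder (I : finType) (P : pred I) (K : nat) (h : I -> R)
    (g : 'I_K -> I -> R) : (0 < K)%N ->
  (forall x, P x -> 0 <= h x) -> (forall j x, P x -> 0 <= g j x) ->
  (forall x, P x -> h x ^+ K <= \prod_j g j x) ->
  (\sum_(x | P x) h x) ^+ K <= \prod_j \sum_(x | P x) g j x.
Proof.
move=> K0 h0 g0 hg.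
have G0 j : 0 <= \sum_(x | P x) g j x by apply: sumr_ge0 => x; exact: g0.
have [/existsP[j /eqP Gj]|] := boolP [exists j, \sum_(x | P x) g j x == 0].
  rewrite big1 => [|x Px].
    by rewrite expr0n gtn_eqF//; apply: prodr_ge0.
  have gjx : g j x = 0 by apply: psumr_eq0P Gj x Px => y; exact: g0.
  have := hg _ Px; rewrite (bigD1 j)//= gjx mul0r => hx.
  have /eqP : h x ^+ K = 0 by apply/le_anti; rewrite hx exprn_ge0// h0.
  by rewrite expf_eq0 K0 => /eqP.
rewrite negb_exists => /forallP Gne.
have Gp j : 0 < \sum_(x | P x) g j x by rewrite lt0r Gne G0.
have Pp : 0 < \prod_j \sum_(x | P x) g j x by apply: prodr_gt0.
have [y y0 yK] := root_exists K0 (ltW Pp).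
have yp : 0 < y.
  rewrite lt_neqAle y0 andbT; apply: contraTneq Pp => y0'.
  by rewrite -yK -y0' expr0n gtn_eqF// ltxx.
rewrite -yK lerXn2r ?nnegrE ?sumr_ge0//.
have le1 x : P x -> h x / y <= (\sum_j g j x / \sum_(x | P x) g j x) / K%:R.
  move=> Px; have a0 j : 0 <= g j x / \sum_(x | P x) g j x.
    by rewrite divr_ge0// g0.
  rewrite -(@ler_pXn2r _ K)// ?nnegrE ?divr_ge0 ?h0 ?sumr_ge0//.
  have [+ _] := @leif_AGM _ _ [set: 'I_K]%SET
    (fun j => g j x / \sum_(x | P x) g j x) (fun j _ => a0 j).
  rewrite cardsT card_ord.
  under eq_bigl do rewrite inE.
  under [X in X / _]eq_bigl do rewrite inE.
  apply: le_trans.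
  by rewrite expr_div_n yK big_split/= prodfV ler_pM2r ?invr_gt0// hg.
rewrite -[leRHS]mul1r -ler_pdivrMr// mulr_suml.
apply: le_trans (ler_sum _ le1) _; rewrite -[leLHS]mulr_suml exchange_big/=.
rewrite (eq_bigr (fun=> 1)) => [|j _]; last by rewrite -mulr_suml divff.
by rewrite sumr_const card_ord divff// pnatr_eq0 -lt0n.
Qed.

(** Two functions with multiplicities, the only shape in which the inequality
    is applied apart from Blei's. *)
Lemma holder_pow (I : finType) (P : pred I) (a b : nat) (h f g : I -> R) :
  (0 < a + b)%N ->
  (forall x, P x -> 0 <= h x) -> (forall x, P x -> 0 <= f x) ->
  (forall x, P x -> 0 <= g x) ->
  (forall x, P x -> h x ^+ (a + b) <= f x ^+ a * g x ^+ b) ->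
  (\sum_(x | P x) h x) ^+ (a + b) <=
  (\sum_(x | P x) f x) ^+ a * (\sum_(x | P x) g x) ^+ b.
Proof.
move=> ab h0 f0 g0 hfg.
pose G (j : 'I_(a + b)) := if fintype.split j then f else g.
have PG (F : (I -> R) -> R) : \prod_j F (G j) = F f ^+ a * F g ^+ b.
  rewrite big_split_ord/=; congr (_ * _).
    rewrite (eq_bigr (fun=> F f)) ?prodr_const ?card_ord// => i _.
    by rewrite /G -/(unsplit (inl i)) unsplitK.
  rewrite (eq_bigr (fun=> F g)) ?prodr_const ?card_ord// => i _.
  by rewrite /G -/(unsplit (inr i)) unsplitK.
have := @holder I P (a + b) h G ab h0.
rewrite (PG (fun f => \sum_(x | P x) f x)); apply.
  by move=> j x Px; rewrite /G; case: (fintype.split j) => ?; [exact: f0|exact: g0].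
by move=> x Px; rewrite (PG (fun f => f x)) hfg.
Qed.

Lemma cauchy_schwarz (I : finType) (P : pred I) (h f g : I -> R) :
  (forall x, P x -> 0 <= h x) -> (forall x, P x -> 0 <= f x) ->
  (forall x, P x -> 0 <= g x) ->
  (forall x, P x -> h x ^+ 2 <= f x * g x) ->
  (\sum_(x | P x) h x) ^+ 2 <= (\sum_(x | P x) f x) * (\sum_(x | P x) g x).
Proof.
move=> h0 f0 g0 hfg; have := @holder_pow I P 1 1 h f g isT h0 f0 g0.
by rewrite !expr1; apply.
Qed.

(** The inequality is one application of Hoelder's to the factorisation
    of u^(2k) as the product of the k functions u^2 / v_s and of prod_s v_s:
    each of them sums to a product of the mixed norms sum_a v_s(a). *)
Lemma blei (k n : nat) (u q : {ffun 'I_k -> 'I_n} -> R)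
    (v : 'I_k -> 'I_n -> R) : (0 < k)%N ->
  (forall i, 0 <= u i) -> (forall i, 0 <= q i) -> (forall s a, 0 <= v s a) ->
  (forall i, q i ^+ k.+1 = u i ^+ (2 * k)) ->
  (forall s a, \sum_(i : {ffun 'I_k -> 'I_n} | i s == a) u i ^+ 2
     = v s a ^+ 2) ->
  (\sum_i q i) ^+ k.+1 <= (\prod_s \sum_a v s a) ^+ 2.
Proof.
move=> k0 u0 q0 v0 qu uv.
pose g (j : 'I_k.+1) (i : {ffun 'I_k -> 'I_n}) :=
  if unlift ord0 j is Some s then u i ^+ 2 / v s (i s)
  else \prod_s v s (i s).
have Pg (F : ({ffun 'I_k -> 'I_n} -> R) -> R) : \prod_j F (g j) =
    F (fun i => \prod_s v s (i s)) *
    \prod_s F (fun i => u i ^+ 2 / v s (i s)).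
  rewrite big_ord_recl /g unlift_none; congr (_ * _).
  by apply: eq_bigr => s _; rewrite liftK.
have := @holder _ xpredT k.+1 q g isT (fun i _ => q0 i).
rewrite (Pg (fun f => \sum_i f i)) -bigA_distr_bigA /=.
have E s : \sum_i u i ^+ 2 / v s (i s) = \sum_a v s a.
  rewrite (partition_big (fun i : {ffun 'I_k -> 'I_n} => i s) xpredT)//=.
  apply: eq_bigr => a _.
  rewrite (eq_bigr (fun i => u i ^+ 2 / v s a)); last by move=> i /eqP ->.
  rewrite -mulr_suml uv; have [->|va] := eqVneq (v s a) 0.
    by rewrite invr0 mulr0.
  by rewrite expr2 mulfK.
rewrite (eq_bigr _ (fun s _ => E s)) -expr2; apply.
  move=> j i _; rewrite /g; case: unlift => [s|]; last exact: prodr_ge0.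
  by rewrite divr_ge0// exprn_ge0.
move=> i _; rewrite (Pg (fun f => f i)) qu.
have [/existsP[s /eqP vs]|] := boolP [exists s, v s (i s) == 0].
  have : u i ^+ 2 <= v s (i s) ^+ 2.
    rewrite -uv (bigD1 i)//= lerDl sumr_ge0// => j _.
    by rewrite exprn_ge0.
  rewrite vs expr0n/= => ui.
  have /eqP : u i ^+ 2 = 0 by apply/le_anti; rewrite ui sqr_ge0.
  rewrite sqrf_eq0 => /eqP ->.
  rewrite expr0n muln_eq0 /= gtn_eqF// mulr_ge0// prodr_ge0// => t _.
  by rewrite expr0n /= mul0r.
rewrite negb_exists => /forallP vn.
rewrite -big_split/= (eq_bigr (fun=> u i ^+ 2)) => [|s _].
  by rewrite prodr_const card_ord -exprM.
by rewrite mulrCA divff ?mulr1.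
Qed.

End Holder.

(** * Means over the torus *)

Section Torus.
Variable R : realType.
Local Notation C := (complex R).

Definition avg (T : finType) (f : T -> R) : R := (\sum_x f x) / #|T|%:R.

(** The exponents lie in a finite box of side D: a mean over N-th roots of
    unity separates them as soon as D <= N. *)
Definition box_poly n D (b : {ffun 'I_n -> 'I_D} -> C) (z : 'I_n -> C) : C :=
  \sum_(g : {ffun 'I_n -> 'I_D}) b g * \prod_a z a ^+ g a.

Definition torus_point n N (w : C) (e : {ffun 'I_n -> 'I_N}) : 'I_n -> C :=
  fun a => w ^+ e a.

Lemma monomial_orth n D N (w : C) (g g' : {ffun 'I_n -> 'I_D}) :
  N.-primitive_root w -> (D <= N)%N ->
  \sum_(e : {ffun 'I_n -> 'I_N})
     (\prod_a torus_point w e a ^+ g a) * conjc (\prod_a torus_point w e a ^+ g' a) =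
  (N ^ n * (g == g'))%:R.
Proof.
move=> pw DN.
under eq_bigr => e _ do rewrite rmorph_prod -big_split/=.
rewrite -(bigA_distr_bigA (fun a (j : 'I_N) =>
  (w ^+ j) ^+ g a * conjc ((w ^+ j) ^+ g' a))).
rewrite (eq_bigr (fun a => (N * (g a == g' a))%:R : C)) => [|a _]; last first.
  rewrite -(root_orth pw); [|exact: leq_trans (ltn_ord _) DN..].
  by apply: eq_bigr => j _; rewrite -!exprM.
have [->|gg'] := eqVneq g g'.
  under eq_bigr => a _ do rewrite eqxx muln1.
  by rewrite prodr_const card_ord muln1 natrX.
have [a ga] : exists a, g a != g' a.
  apply/existsP; apply: contraR gg'; rewrite negb_exists => /forallP h.
  by apply/eqP/ffunP => a; apply/eqP; rewrite -[_ == _]negbK h.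
rewrite (bigD1 a)//= -(inj_eq val_inj) /= in ga *.
by rewrite -[_ == _ :> nat]negbK ga /= !muln0 mul0r.
Qed.

Lemma avgE n N (f : {ffun 'I_n -> 'I_N} -> R) :
  avg f = (\sum_e f e) / (N ^ n)%:R.
Proof. by rewrite /avg card_ffun !card_ord. Qed.

Lemma parseval n D N (w : C) (b : {ffun 'I_n -> 'I_D} -> C) :
  N.-primitive_root w -> (D <= N)%N ->
  avg (fun e : {ffun 'I_n -> 'I_N} => cn (box_poly b (torus_point w e)) ^+ 2) =
  \sum_g cn (b g) ^+ 2.
Proof.
move=> pw DN; have N0 := prim_order_gt0 pw.
have N1 : ((N ^ n)%:R : R) != 0 by rewrite pnatr_eq0 -lt0n expn_gt0 N0.
rewrite avgE; apply: (mulIf N1); rewrite divfK//.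
apply: (@complexI R); rewrite rmorphM/= !rmorph_sum/= rmorph_nat.
under eq_bigr => e _ do rewrite cn_sqr rmorph_sum/= big_distrlr/=.
rewrite exchange_big/= mulr_suml; apply: eq_bigr => g _.
rewrite exchange_big/=.
rewrite (eq_bigr (fun g' => b g * conjc (b g') * (N ^ n * (g == g'))%:R)).
  rewrite (bigD1 g)//= big1 ?addr0 ?eqxx ?muln1 ?cn_sqr// => g'.
  by rewrite eq_sym => /negPf ->; rewrite muln0 mulr0.
move=> g' _; rewrite -(monomial_orth g g' pw DN) mulr_sumr.
by apply: eq_bigr => e _; rewrite rmorphM mulrACA.
Qed.

(** The multi-indices below g number at most the product of the g_a + 1,
    and g_a + 1 <= 2 ^ g_a. *)
Lemma card_below_le (n D : nat) (g : 'I_n -> nat) :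
  (#|[set f : {ffun 'I_n -> 'I_D} | [forall a, (f a <= g a)%N]]| <=
   2 ^ (\sum_a g a))%N.
Proof.
rewrite -sum1_card big_mkcond/= (eq_bigr (fun f : {ffun 'I_n -> 'I_D} =>
    (\prod_a (f a <= g a : nat))%N)).
  rewrite -(bigA_distr_bigA (fun a (j : 'I_D) => (j <= g a : nat)%N)).
  rewrite (big_morph _ (expnD 2) (erefl : 2 ^ 0 = 1)%N).
  apply: leq_prod => a _; apply: leq_trans (_ : (g a).+1 <= _)%N.
    rewrite -[leqRHS]card_ord -sum1_card.
    rewrite (big_ord_widen_cond (maxn D (g a).+1) xpredT (fun j => (j <= g a : nat)%N)) ?leq_maxl//.
    rewrite [leqRHS](big_ord_widen_cond (maxn D (g a).+1) xpredT (fun=> 1%N)) ?leq_maxr//.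
    rewrite big_mkcond [leqRHS]big_mkcond/=; apply: leq_sum => j _.
    by rewrite ltnS; case: (j < D)%N => //; case: (j <= g a)%N.
  exact: ltn_expl.
move=> f _; rewrite inE; have [/forallP h|] := boolP [forall a, (f a <= g a)%N].
  by rewrite big1// => a _; rewrite h.
rewrite negb_forall => /existsP[a /negPf h].
by rewrite (bigD1 a)//= h mul0n.
Qed.

Definition wdeg n D (g : {ffun 'I_n -> 'I_D}) : nat := (\sum_a g a)%N.

(** The square of the polynomial has the convolution square of b as
    coefficients, and a multi-index c is a sum of two in at most 2^|c| ways. *)
Lemma mean4_le n D N (w : C) (b : {ffun 'I_n -> 'I_D} -> C) :
  N.-primitive_root w -> (D + D <= N)%N ->
  avg (fun e : {ffun 'I_n -> 'I_N} => cn (box_poly b (torus_point w e)) ^+ 4) <=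
  (\sum_g 2 ^+ wdeg g * cn (b g) ^+ 2) ^+ 2.
Proof.
move=> pw DN.
have lt2 (p : {ffun 'I_n -> 'I_D} * {ffun 'I_n -> 'I_D}) a :
  (p.1 a + p.2 a < D + D)%N by rewrite -addSn leq_add// ltnW.
pose sm p : {ffun 'I_n -> 'I_(D + D)} := [ffun a => Ordinal (lt2 p a)].
pose c g := \sum_(p | sm p == g) b p.1 * b p.2.
have sq z : box_poly b z ^+ 2 = box_poly c z.
  rewrite expr2 /box_poly big_distrlr/= pair_bigA/=.
  rewrite (partition_big sm xpredT)//=; apply: eq_bigr => g _.
  rewrite mulr_suml; apply: eq_bigr => p /eqP <-.
  rewrite mulrACA -big_split/=; congr (_ * _); apply: eq_bigr => a _.
  by rewrite ffunE/= exprD.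
have -> : avg (fun e : {ffun 'I_n -> 'I_N} => cn (box_poly b (torus_point w e)) ^+ 4) =
  avg (fun e : {ffun 'I_n -> 'I_N} => cn (box_poly c (torus_point w e)) ^+ 2).
  congr (_ / _); apply: eq_bigr => e _.
  by rewrite -sq cnX -exprM.
rewrite (parseval _ pw DN) expr2 big_distrlr/= pair_bigA/=.
rewrite [leRHS](partition_big sm xpredT)//=; apply: ler_sum => g _.
pose T := \sum_(p | sm p == g) (cn (b p.1) ^+ 2 * cn (b p.2) ^+ 2).
apply: (@le_trans _ _ ((\sum_(p | sm p == g) 1) * T)).
  have := @cauchy_schwarz R _ (fun p => sm p == g)
    (fun p => cn (b p.1 * b p.2)) (fun=> 1)
    (fun p => cn (b p.1) ^+ 2 * cn (b p.2) ^+ 2).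
  have h := cn_sum (index_enum _) (fun p => sm p == g) (fun p => b p.1 * b p.2).
  move=> /(_ _ _ _ _) cs; apply: le_trans (cs _ _ _ _) => //.
  - by rewrite lerXn2r ?nnegrE ?cn_ge0 ?sumr_ge0// => *; exact: cn_ge0.
  - by move=> *; exact: cn_ge0.
  - by move=> *; rewrite mulr_ge0 ?exprn_ge0 ?cn_ge0.
  - by move=> *; rewrite mul1r cnM exprMn.
have -> : \sum_(p | sm p == g) 2 ^+ wdeg p.1 * cn (b p.1) ^+ 2 *
    (2 ^+ wdeg p.2 * cn (b p.2) ^+ 2) = (2 ^ (\sum_a g a))%:R * T.
  rewrite mulr_sumr; apply: eq_bigr => p /eqP <-.
  rewrite mulrACA -exprD natrX; congr (_ ^+ _ * _).
  by rewrite /wdeg -big_split/=; apply: eq_bigr => a _; rewrite ffunE.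
rewrite ler_wpM2r ?sumr_ge0// => [*|]; first by rewrite mulr_ge0 ?exprn_ge0 ?cn_ge0.
rewrite sumr_const ler_nat.
apply: leq_trans (card_below_le D (fun a => g a : nat)).
rewrite -[leqLHS](@card_in_imset _ _ fst [pred p | sm p == g]).
  apply: subset_leq_card; apply/fintype.subsetP => f /imsetP[p].
  rewrite !inE => /eqP <- ->; apply/forallP => a.
  by rewrite ffunE/= leq_addr.
move=> [f1 f2] [h1 h2]; rewrite !inE => /eqP e1 /eqP e2 /= e; congr (_, _) => //.
apply/ffunP => a; apply: val_inj.
have := congr1 (fun h : {ffun 'I_n -> 'I_(D + D)} => val (h a)) (etrans e1 (esym e2)).
by rewrite !ffunE /= e => /addnI.
Qed.
End Torus.

(** * Homogeneous forms on a commutative algebra *)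

Section Forms.
Variable R : realType.
Local Notation C := (complex R).
Variables (A : comAlgType C) (n : nat) (X : 'I_n -> A).

(** The powers of these elements carry the homogeneous polynomials: a linear
    functional on A turns them into forms in z. *)
Definition lform (z : 'I_n -> C) : A := \sum_a z a *: X a.

(** The letters of the word i multiplied out; a functional takes the same
    value on words that differ by a permutation, which is the symmetry of its
    tensor. *)
Definition xmon l (i : {ffun 'I_l -> 'I_n}) : A := \prod_s X (i s).

Lemma lformX l z : lform z ^+ l =
  \sum_(i : {ffun 'I_l -> 'I_n}) (\prod_s z (i s)) *: xmon i.
Proof.
transitivity (\prod_(s < l) lform z); first by rewrite prodr_const card_ord.
rewrite /lform bigA_distr_bigA; apply: eq_bigr => i _.
by rewrite scaler_prod.
Qed.

Lemma scalar_sum (psi : A -> C) (I : Type) (r : seq I) (c : I -> C)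
  (x : I -> A) : scalar psi ->
  psi (\sum_(i <- r) c i *: x i) = \sum_(i <- r) c i * psi (x i).
Proof.
move=> hl; have p0 : psi 0 = 0.
  have := hl 1 0 0; rewrite scale1r addr0 mul1r => /esym/eqP.
  by rewrite -subr_eq0 addrK => /eqP.
elim/big_rec2: _ => [//|i y1 y2 _ <-].
exact: hl.
Qed.

Definition letter_count l (i : {ffun 'I_l -> 'I_n}) (a : 'I_n) : nat :=
  #|[pred s | i s == a]|.

Lemma letter_count_lt l (i : {ffun 'I_l -> 'I_n}) a : (letter_count i a < l.+1)%N.
Proof. by rewrite ltnS -[leqRHS]card_ord max_card. Qed.

Definition mtype l (i : {ffun 'I_l -> 'I_n}) : {ffun 'I_n -> 'I_l.+1} :=
  [ffun a => Ordinal (letter_count_lt i a)].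

Lemma prod_letter_count (S : comNzRingType) l (i : {ffun 'I_l -> 'I_n}) (y : 'I_n -> S) :
  \prod_s y (i s) = \prod_a y a ^+ mtype i a.
Proof.
rewrite (partition_big (fun s => i s) xpredT)//=; apply: eq_bigr => a _.
rewrite (eq_bigr (fun=> y a)) => [|s /eqP ->//].
by rewrite prodr_const ffunE.
Qed.

Lemma wdeg_mtype l (i : {ffun 'I_l -> 'I_n}) : wdeg (mtype i) = l.
Proof.
rewrite /wdeg -[RHS]card_ord -sum1_card (partition_big (fun s => i s) xpredT)//=.
by apply: eq_bigr => a _; rewrite ffunE /= sum1_card.
Qed.

Section Functional.
Variables (psi : A -> C) (l : nat).
Hypothesis psi_lin : scalar psi.

(** Coefficient of the form at the monomial of type g: a tensor entry, times
    the number of words of that type. *)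
Definition fcoef (g : {ffun 'I_n -> 'I_l.+1}) : C :=
  \sum_(i : {ffun 'I_l -> 'I_n} | mtype i == g) psi (xmon i).

Lemma form_box_poly z : psi (lform z ^+ l) = box_poly fcoef z.
Proof.
rewrite lformX scalar_sum// (partition_big (@mtype l) xpredT)//=.
apply: eq_bigr => g _; rewrite mulr_suml; apply: eq_bigr => i /eqP <-.
by rewrite prod_letter_count mulrC.
Qed.

Lemma fcoef_hom g : wdeg g != l -> fcoef g = 0.
Proof.
move=> gl; rewrite /fcoef big1// => i /eqP ig.
by move: gl; rewrite -ig wdeg_mtype eqxx.
Qed.

Lemma cn_fcoef g : cn (fcoef g) =
  \sum_(i : {ffun 'I_l -> 'I_n} | mtype i == g) cn (psi (xmon i)).
Proof.
pose y := psi (\prod_a X a ^+ g a).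
have E (i : {ffun 'I_l -> 'I_n}) : mtype i == g -> psi (xmon i) = y.
  by move=> /eqP ig; rewrite /xmon prod_letter_count ig.
rewrite /fcoef (eq_bigr _ E) (eq_bigr (fun=> cn y)) => [|i /E -> //].
by rewrite !sumr_const -mulr_natl cnM cn_nat mulr_natl.
Qed.

Lemma sum_cn_xmon :
  \sum_(i : {ffun 'I_l -> 'I_n}) cn (psi (xmon i)) = \sum_g cn (fcoef g).
Proof.
rewrite (partition_big (@mtype l) xpredT)//=.
by apply: eq_bigr => g _; rewrite cn_fcoef.
Qed.

Variables (N : nat) (w : C).
Hypothesis pw : N.-primitive_root w.
Hypothesis lN : (l.+1 + l.+1 <= N)%N.
Let mean (f : C -> R) :=
  avg (fun e : {ffun 'I_n -> 'I_N} => f (psi (lform (torus_point w e) ^+ l))).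

Lemma mean2E : mean (fun y => cn y ^+ 2) = \sum_g cn (fcoef g) ^+ 2.
Proof.
rewrite -(parseval _ pw) ?(leq_trans _ lN) ?leq_addr//.
by congr (_ / _); apply: eq_bigr => e _; rewrite form_box_poly.
Qed.

(** An entry shared by M words contributes M times its square on the left,
    and the square of M times itself on the right. *)
Lemma form_l2 : \sum_(i : {ffun 'I_l -> 'I_n}) cn (psi (xmon i)) ^+ 2 <=
  mean (fun y => cn y ^+ 2).
Proof.
rewrite mean2E (partition_big (@mtype l) xpredT)//=; apply: ler_sum => g _.
rewrite cn_fcoef expr2 mulr_suml; apply: ler_sum => i ig.
rewrite expr2 ler_wpM2l ?cn_ge0// (bigD1 i)//= lerDl sumr_ge0// => j _.
exact: cn_ge0.
Qed.

Definition nb_monomials := #|[set g : {ffun 'I_n -> 'I_l.+1} | wdeg g == l]|.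

(** Cauchy-Schwarz over the monomials rather than over the words: the
    multiplicities are absorbed in the coefficients of the form. *)
Lemma form_l1 : (\sum_(i : {ffun 'I_l -> 'I_n}) cn (psi (xmon i))) ^+ 2 <=
  nb_monomials%:R * mean (fun y => cn y ^+ 2).
Proof.
rewrite sum_cn_xmon mean2E.
have E (F : R -> R) : F 0 = 0 -> \sum_g F (cn (fcoef g)) =
    \sum_(g | wdeg g == l) F (cn (fcoef g)).
  move=> F0; rewrite [RHS]big_mkcond; apply: eq_bigr => g _.
  by case: ifPn => // /fcoef_hom ->; rewrite cn0.
rewrite (E id)// (E (fun x => x ^+ 2)) ?expr0n//.
have -> : nb_monomials%:R = \sum_(g : {ffun 'I_n -> 'I_l.+1} | wdeg g == l) 1 :> R.
  by rewrite sumr_const /nb_monomials cardsE.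
apply: cauchy_schwarz => g _ //; rewrite ?cn_ge0 ?exprn_ge0 ?cn_ge0//.
by rewrite mul1r.
Qed.

Lemma form_l4 : mean (fun y => cn y ^+ 4) <=
  4 ^+ l * mean (fun y => cn y ^+ 2) ^+ 2.
Proof.
have := mean4_le fcoef pw lN.
have -> : \sum_g 2 ^+ wdeg g * cn (fcoef g) ^+ 2 =
    2 ^+ l * mean (fun y => cn y ^+ 2).
  rewrite mean2E mulr_sumr; apply: eq_bigr => g _.
  have [-> //|/fcoef_hom ->] := eqVneq (wdeg g) l.
  by rewrite cn0 expr0n !mulr0.
have e4 : (2 ^+ l) ^+ 2 = 4 ^+ l :> R.
  by rewrite -exprM mulnC exprM -natrX.
rewrite exprMn e4; apply: le_trans.
rewrite le_eqVlt; apply/orP; left; apply/eqP.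
by congr (_ / _); apply: eq_bigr => e _; rewrite form_box_poly.
Qed.

(** Hoelder between the exponents 2k/(k+1) and 4. The function q is the
    power |h|^(2k/(k+1)); for k = 1 this compares the quadratic mean with
    the mean, and the constant 4^(l/k) improves to 1 as k grows. *)
Lemma form_hyper k (q : {ffun 'I_n -> 'I_N} -> R) : (0 < k)%N ->
  (forall e, 0 <= q e) ->
  (forall e, q e ^+ k.+1 = cn (psi (lform (torus_point w e) ^+ l)) ^+ (2 * k)) ->
  mean (fun y => cn y ^+ 2) ^+ k <= 4 ^+ l * avg q ^+ k.+1.
Proof.
move=> k0 q0 qk.
set E2 := mean _.
have E0 (f : C -> R) : (forall y, 0 <= f y) -> 0 <= mean f.
  by move=> f0; rewrite divr_ge0// sumr_ge0.
have E20 : 0 <= E2 by apply: E0 => y; rewrite exprn_ge0 ?cn_ge0.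
have aq0 : 0 <= avg q by rewrite divr_ge0// sumr_ge0.
have [-> |E2n] := eqVneq E2 0.
  by rewrite expr0n gtn_eqF// mulr_ge0// ?exprn_ge0.
have E2p : 0 < E2 by rewrite lt_neqAle eq_sym E2n.
rewrite -(ler_pM2r (exprn_gt0 2 E2p)) -exprD.
apply: (@le_trans _ _ (avg q ^+ k.+1 * mean (fun y => cn y ^+ 4))); last first.
  rewrite [leRHS]mulrAC mulrC ler_wpM2r ?exprn_ge0//.
  exact: form_l4.
have := @holder_pow R _ xpredT k.+1 1
  (fun e : {ffun 'I_n -> 'I_N} => cn (psi (lform (torus_point w e) ^+ l)) ^+ 2) q
  (fun e => cn (psi (lform (torus_point w e) ^+ l)) ^+ 4) isT.
rewrite addn1 addn2 expr1 => /(_ _ _ _ _) H.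
rewrite /E2 /mean /avg !expr_div_n.
set M := #|_|%:R; have M0 : 0 <= M by [].
rewrite mulrACA -invfM -exprSr ler_wpM2r ?invr_ge0 ?exprn_ge0//.
apply: H => // e _; rewrite ?exprn_ge0 ?cn_ge0//.
by rewrite qk -!exprM -exprD (_ : 2 * k.+2 = 2 * k + 4)%N//; lia.
Qed.
End Functional.
End Forms.

(** * Cauchy estimates and polarization *)

Section Cauchy.
Variable R : realType.
Local Notation C := (complex R).

Lemma fourier_coef N (w : C) (c : nat -> C) k : N.-primitive_root w ->
  (k < N)%N ->
  \sum_(j < N) (\sum_(i < N) w ^+ (j * i) * c i) * conjc (w ^+ (j * k)) =
  N%:R * c k.
Proof.
move=> pw kN.
under eq_bigr => j _ do rewrite mulr_suml.
rewrite exchange_big/= (bigD1 (Ordinal kN))//= [X in _ + X]big1 ?addr0.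
  rewrite -[N%:R](_ : (N * (k == k))%:R = _); last by rewrite eqxx muln1.
  rewrite -(root_orth pw kN kN) mulr_suml; apply: eq_bigr => j _.
  by rewrite mulrAC.
move=> i ik; rewrite (eq_bigr (fun j : 'I_N =>
   w ^+ (j * i) * conjc (w ^+ (j * k)) * c i)) => [|j _]; last by rewrite mulrAC.
rewrite -mulr_suml (root_orth pw)//.
by move: ik; rewrite -(inj_eq val_inj)/= => /negPf ->; rewrite muln0 mul0r.
Qed.

(** The Fourier coefficient of index k on the circle of radius rho, taken on
    N-th roots of unity. *)
Lemma cauchy_estimate N (c : nat -> C) k (rho B : R) :
  (k < N)%N -> 0 <= rho ->
  (forall s, cn s = rho -> cn (\sum_(i < N) s ^+ i * c i) <= B) ->
  rho ^+ k * cn (c k) <= B.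
Proof.
move=> kN rho0 H; have N0 : (0 < N)%N by case: N kN {H}.
have [w pw] := prim_root_exists R N0; have w1 := prim_cn pw.
have := fourier_coef (fun i => (rho%:C%C) ^+ i * c i) pw kN.
move=> /(congr1 (@Normc.normc R)); rewrite !cnM cn_nat cnX cn_real ger0_norm//.
move=> E; rewrite -(@ler_pM2l _ N%:R) ?ltr0n// -E.
apply: le_trans (cn_sum _ _ _) _.
rewrite -[X in X%:R * B]card_ord mulr_natl -sumr_const; apply: ler_sum => j _.
rewrite cnM cnJ cnX w1 expr1n mulr1.
rewrite (eq_bigr (fun i : 'I_N => (rho%:C%C * w ^+ j) ^+ i * c i)).
  by apply: H; rewrite cnM cn_real cnX w1 expr1n mulr1 ger0_norm.
by move=> i _; rewrite exprMn exprM mulrCA mulrA.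
Qed.

Lemma cauchy_binomial (A : comAlgType C) (psi : A -> C) (x y : A) m k
    (rho B : R) : scalar psi -> (k <= m)%N -> 0 <= rho ->
  (forall s, cn s = rho -> cn (psi ((x + s *: y) ^+ m)) <= B) ->
  rho ^+ k * ('C(m, k)%:R * cn (psi (x ^+ (m - k) * y ^+ k))) <= B.
Proof.
move=> hl km rho0 H.
rewrite -cn_nat -cnM.
apply: (@cauchy_estimate m.+1
  (fun i => 'C(m, i)%:R * psi (x ^+ (m - i) * y ^+ i)) k rho B) => // s /H.
rewrite exprDn.
rewrite (eq_bigr (fun i : 'I_m.+1 =>
  (s ^+ i * 'C(m, i)%:R) *: (x ^+ (m - i) * y ^+ i))).
  by rewrite scalar_sum//; under eq_bigr => i _ do rewrite -mulrA.
move=> i _; rewrite exprZn -scalerAr mulrC -scalerA [in RHS]scaler_nat.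
by rewrite scalerMnr.
Qed.

End Cauchy.

Section Polarization.
Variable R : realType.
Local Notation C := (complex R).
Variables (A : comAlgType C) (n : nat) (X : 'I_n -> A).

Definition bounded_on_polydisk (phi : A -> C) (m : nat) (B : R) :=
  forall z : 'I_n -> C, (forall a, cn (z a) <= 1) ->
  cn (phi (lform X z ^+ m)) <= B.

Lemma lformD (z v : 'I_n -> C) (t : C) :
  lform X (fun a => z a + t * v a) = lform X z + t *: lform X v.
Proof.
rewrite /lform scaler_sumr -big_split/=; apply: eq_bigr => a _.
by rewrite scalerDl scalerA.
Qed.

Lemma lformZ (z : 'I_n -> C) (t : C) :
  lform X (fun a => t * z a) = t *: lform X z.
Proof. by rewrite /lform scaler_sumr; apply: eq_bigr => a _; rewrite scalerA. Qed.

Lemma scalarZ (phi : A -> C) t x : scalar phi -> phi (t *: x) = t * phi x.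
Proof.
move=> hl; have := @scalar_sum R A phi unit [:: tt] (fun=> t) (fun=> x) hl.
by rewrite !big_seq1.
Qed.

(** Two Cauchy estimates, on circles of radius 1/m and 1, pass from the
    polynomial to its polar form; for fixed k the loss is polynomial in m. *)
Lemma polarization (phi : A -> C) (k l : nat) (B : R) :
  scalar phi -> bounded_on_polydisk phi (k.+1 + l) B ->
  forall z v w : 'I_n -> C, (forall a, cn (z a) <= 1) ->
  (forall a, cn (v a) <= 1) -> (forall a, cn (w a) <= 1) ->
  cn (phi (lform X v * lform X w ^+ k * lform X z ^+ l)) <=
  expR 2 * (k.+1 + l)%:R ^+ k.+1 * B.
Proof.
move=> hl HB z v w z1 v1 w1; set m := (k.+1 + l)%N.
have m0 : 0 < m%:R :> R by rewrite ltr0n.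
have B0 : 0 <= B.
  apply: le_trans (HB (fun=> 0) _); first exact: cn_ge0.
  by move=> a; rewrite cn0.
have S1 s : cn s = 1 ->
    cn (phi (lform X z ^+ l * (lform X w + s *: lform X v) ^+ k.+1)) <=
    expR 2 * m%:R ^+ k.+1 * B.
  move=> s1; rewrite -lformD; set y := fun a => _.
  have y2 a : cn (y a) <= 2.
    apply: le_trans (cnD _ _) _; rewrite cnM s1 mul1r.
    by rewrite -[2]/(1 + 1) lerD.
  have := @cauchy_binomial R A phi (lform X z) (lform X y) m k.+1
    (m%:R^-1) (expR 2 * B) hl (leq_addr _ _).
  rewrite invr_ge0 ler0n => /(_ isT) H.
  rewrite {1}/m addKn in H.
  have {}H := H _.
  rewrite mulrAC -ler_pdivrMr ?exprn_gt0// mulrC -exprVn.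
  apply: le_trans (H _); last first.
    move=> t tm; rewrite -lformD.
    set q : R := 1 + 2 / m%:R.
    have q0 : 0 < q by rewrite addr_gt0// divr_gt0.
    have -> : lform X (fun a => z a + t * y a) =
        q%:C%C *: lform X (fun a => (q^-1)%:C%C * (z a + t * y a)).
      by rewrite lformZ scalerA -rmorphM divff ?gt_eqF// scale1r.
    rewrite exprZn scalarZ// cnM cnX cn_real gtr0_norm//.
    apply: ler_pM; rewrite ?exprn_ge0 ?cn_ge0 ?(ltW q0)//.
      have -> : expR 2 = expR (2 / m%:R) ^+ m :> R.
        by rewrite -expRM_natl mulrC divfK ?gt_eqF.
      by apply: lerXn2r; rewrite ?nnegrE ?expR_ge0 ?(ltW q0)// expR_ge1Dx.
    apply: HB => a; rewrite cnM cn_real gtr0_norm ?invr_gt0//.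
    rewrite mulrC ler_pdivrMr// mul1r.
    apply: le_trans (cnD _ _) _; apply: lerD => //.
    by rewrite cnM tm mulrC ler_pM2r ?invr_gt0.
  rewrite ler_wpM2l ?exprn_ge0 ?invr_ge0// ler_peMl ?cn_ge0//.
  by rewrite ler1n bin_gt0 leq_addr.
pose psi y := phi (lform X z ^+ l * y).
have psil : scalar psi.
  by move=> c x y; rewrite /psi mulrDr -scalerAr hl.
have := @cauchy_binomial R A psi (lform X w) (lform X v) k.+1 1 1 _ psil
  (ltn0Sn k) ler01 S1.
rewrite expr1n mul1r bin1 subn1 expr1 /= /psi.
rewrite [lform X z ^+ l * _]mulrC [_ ^+ k * _]mulrC; apply: le_trans.
by rewrite ler_peMl ?cn_ge0// ler1n.
Qed.

End Polarization.

(** * The sum of the moduli of the coefficients *)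

Section CoefficientSum.
Variable R : realType.
Local Notation C := (complex R).
Variables (A : comAlgType C) (n : nat) (X : 'I_n -> A).

(** By symmetry of the tensor the fixed slot may be any one; this makes all
    the mixed norms in Blei's inequality equal. *)
Lemma slice_sum (k : nat) (s : 'I_k.+1) (a : 'I_n) (F : A -> R) :
  \sum_(i : {ffun 'I_k.+1 -> 'I_n} | i s == a) F (xmon X i) =
  \sum_(i : {ffun 'I_k -> 'I_n}) F (X a * xmon X i).
Proof.
pose h (i : {ffun 'I_k -> 'I_n}) : {ffun 'I_k.+1 -> 'I_n} :=
  [ffun t => if unlift s t is Some t' then i t' else a].
have hs i : h i s = a by rewrite ffunE unlift_none.
rewrite (reindex h); last first.
  exists (fun i : {ffun 'I_k.+1 -> 'I_n} => [ffun t => i (lift s t)]).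
    by move=> i _; apply/ffunP => t; rewrite !ffunE liftK.
  move=> i; rewrite inE => /eqP ia; apply/ffunP => t; rewrite ffunE.
  by case: unliftP => [t' ->|->//]; rewrite ffunE.
apply: eq_big => [i|i _]; first by rewrite hs eqxx.
congr F; rewrite /xmon (bigD1_ord s)//= hs; congr (_ * _).
by apply: eq_bigr => t _; rewrite ffunE liftK.
Qed.

Section Bound.
Variables (phi : A -> C) (k l : nat) (B : R).
Hypothesis phil : scalar phi.
Hypothesis phiB : bounded_on_polydisk X phi (k.+1 + l) B.

Let G : R := expR 2 * (k.+1 + l)%:R ^+ k.+1 * B.

(** The quadratic mean over the last k indices is the mean of the modulus of
    a form of degree k in new variables w, up to 2 ^ k; for each w the sum
    over a is a value of the polar form at the vector of conjugate phases. *)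
Lemma mixed_norm (z : 'I_n -> C) : (forall a, cn (z a) <= 1) ->
  \sum_a Num.sqrt (\sum_(i : {ffun 'I_k -> 'I_n})
     cn (phi (X a * xmon X i * lform X z ^+ l)) ^+ 2) <= 2 ^+ k * G.
Proof.
move=> z1.
(* Any order that makes the fourth moments of forms of degree k exact. *)
have [N kN] : {N | (k.+1 + k.+1 <= N)%N} by exists (k.+1 + k.+1)%N.
have N0 : (0 < N)%N by exact: leq_trans kN.
have [w pw] := prim_root_exists R N0; have w1 := prim_cn pw.
pose psi a y := phi (X a * y * lform X z ^+ l).
have psil a : scalar (psi a).
  by move=> c x y; rewrite /psi mulrDr mulrDl -scalerAr -scalerAl phil.
pose f a (e : {ffun 'I_n -> 'I_N}) := cn (psi a (lform X (torus_point w e) ^+ k)).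
have va a : Num.sqrt (\sum_(i : {ffun 'I_k -> 'I_n})
     cn (phi (X a * xmon X i * lform X z ^+ l)) ^+ 2) <= 2 ^+ k * avg (f a).
  have af0 : 0 <= avg (f a).
    by rewrite divr_ge0// sumr_ge0// => e _; exact: cn_ge0.
  rewrite -(@ler_pXn2r _ 2)// ?nnegrE ?sqrtr_ge0//; last exact: mulr_ge0.
  rewrite sqr_sqrtr; last by rewrite sumr_ge0// => i _; rewrite exprn_ge0 ?cn_ge0.
  have H1 := form_l2 X (psil a) pw kN.
  have H2 := @form_hyper R A n X (psi a) k (psil a) N w pw kN 1 (f a) isT
    (fun e => cn_ge0 _) (fun e => erefl).
  apply: le_trans H1 _; rewrite expr1 in H2; apply: le_trans H2 _.
  have e4 : (2 ^+ k) ^+ 2 = 4 ^+ k :> R by rewrite -exprM mulnC exprM -natrX.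
  by rewrite [leRHS]exprMn e4.
apply: le_trans (ler_sum _ (fun a _ => va a)) _.
rewrite -mulr_sumr ler_wpM2l ?exprn_ge0// /avg -mulr_suml exchange_big/=.
have T0 : 0 < #|{ffun 'I_n -> 'I_N}|%:R :> R.
  by rewrite card_ffun !card_ord ltr0n expn_gt0 N0.
rewrite ler_pdivrMr// mulr_natr -sumr_const.
apply: ler_sum => e _.
pose u a := sval (phaseE (psi a (lform X (torus_point w e) ^+ k))).
have u1 a : cn (u a) = 1 by rewrite /u; case: phaseE.
have uE a : u a * psi a (lform X (torus_point w e) ^+ k) = (f a e)%:C%C.
  by rewrite /u; case: phaseE.
apply: le_trans (polarization phil phiB (v := u) (w := torus_point w e) z1 _ _); last 2 first.
- by move=> a; rewrite u1.
- by move=> a; rewrite /torus_point cnX w1 expr1n.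
rewrite [X in phi X](_ : _ = \sum_a u a *: (X a * lform X (torus_point w e) ^+ k
    * lform X z ^+ l)); last first.
  rewrite /lform -mulrA mulr_suml; apply: eq_bigr => a _.
  by rewrite -scalerAl -mulrA.
rewrite (scalar_sum _ _ _ phil) (eq_bigr _ (fun a _ => uE a)) -rmorph_sum.
by rewrite cn_real ler_norm.
Qed.

Lemma blei_at (z : 'I_n -> C) (q : {ffun 'I_k.+1 -> 'I_n} -> R) :
  (forall a, cn (z a) <= 1) -> (forall i, 0 <= q i) ->
  (forall i, q i ^+ k.+2 =
     cn (phi (xmon X i * lform X z ^+ l)) ^+ (2 * k.+1)) ->
  (\sum_i q i) ^+ k.+2 <= (2 ^+ k * G) ^+ (2 * k.+1).
Proof.
move=> z1 q0 qE.
pose v a := Num.sqrt (\sum_(i : {ffun 'I_k -> 'I_n})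
     cn (phi (X a * xmon X i * lform X z ^+ l)) ^+ 2).
have := @blei R k.+1 n (fun i => cn (phi (xmon X i * lform X z ^+ l))) q (fun=> v) isT
  (fun i => cn_ge0 _) q0 (fun s a => sqrtr_ge0 _) qE.
move=> /(_ _)/le_trans; apply.
  move=> s a; rewrite sqr_sqrtr; last first.
    by rewrite sumr_ge0// => i _; rewrite exprn_ge0 ?cn_ge0.
  by rewrite (slice_sum s a (fun y => cn (phi (y * lform X z ^+ l)) ^+ 2)).
rewrite prodr_const card_ord -exprM mulnC.
apply: lerXn2r (mixed_norm z1); rewrite nnegrE.
  by rewrite sumr_ge0// => a _; exact: sqrtr_ge0.
apply: le_trans (mixed_norm z1).
by rewrite sumr_ge0// => a _; exact: sqrtr_ge0.
Qed.

(** A Bohnenblust-Hille type inequality for the sum of moduli. All the loss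
    that is exponential in the degree is in the factor 4 ^ l, that is,
    2 ^ (l / (k+1)) after extraction of the root of order 2 (k+1). *)
Theorem coefficient_sum :
  (\sum_(i : {ffun 'I_k.+1 -> 'I_n}) \sum_(j : {ffun 'I_l -> 'I_n})
     cn (phi (xmon X i * xmon X j))) ^+ (2 * k.+1) <=
  (nb_monomials n l)%:R ^+ k.+1 * (4 ^+ l * (n ^ (k.+1 * k))%:R *
    (2 ^+ k * G) ^+ (2 * k.+1)).
Proof.
have [N kN] : {N | (l.+1 + l.+1 <= N)%N} by exists (l.+1 + l.+1)%N.
have N0 : (0 < N)%N by exact: leq_trans kN.
have [w pw] := prim_root_exists R N0; have w1 := prim_cn pw.
pose psi (i : {ffun 'I_k.+1 -> 'I_n}) y := phi (xmon X i * y).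
have psil i : scalar (psi i) by move=> c x y; rewrite /psi mulrDr -scalerAr phil.
pose f i (e : {ffun 'I_n -> 'I_N}) := cn (psi i (lform X (torus_point w e) ^+ l)).
have qP i e : {y : R | 0 <= y & y ^+ k.+2 = f i e ^+ (2 * k.+1)}.
  by apply: root_exists => //; rewrite exprn_ge0 ?cn_ge0.
pose q i e := s2val (qP i e).
have q0 i e : 0 <= q i e by rewrite /q; case: (qP i e).
have qE i e : q i e ^+ k.+2 = f i e ^+ (2 * k.+1) by rewrite /q; case: (qP i e).
pose E2 i := avg (fun e => f i e ^+ 2).
have E20 i : 0 <= E2 i by rewrite divr_ge0// sumr_ge0// => e _; rewrite exprn_ge0 ?cn_ge0.
have H1 i : E2 i ^+ k.+1 <= 4 ^+ l * avg (q i) ^+ k.+2.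
  exact: (@form_hyper R A n X (psi i) l (psil i) N w pw kN k.+1 (q i) isT (q0 i)
    (qE i)).
have H2 i : \sum_(j : {ffun 'I_l -> 'I_n}) cn (phi (xmon X i * xmon X j)) <=
    Num.sqrt (nb_monomials n l)%:R * Num.sqrt (E2 i).
  rewrite -sqrtrM// -(@ler_pXn2r _ 2)// ?nnegrE ?sqrtr_ge0//; last first.
    by rewrite sumr_ge0// => j _; exact: cn_ge0.
  rewrite sqr_sqrtr; last exact: mulr_ge0.
  exact: (@form_l1 R A n X (psi i) l (psil i) N w pw kN).
apply: (@le_trans _ _ ((Num.sqrt (nb_monomials n l)%:R * \sum_i Num.sqrt (E2 i)) ^+ (2 * k.+1))).
  apply: lerXn2r; rewrite ?nnegrE.
  - by rewrite sumr_ge0// => i _; rewrite sumr_ge0// => j _; exact: cn_ge0.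
  - by rewrite mulr_ge0 ?sqrtr_ge0// sumr_ge0// => i _; exact: sqrtr_ge0.
  - by rewrite mulr_sumr; apply: ler_sum => i _; exact: H2.
rewrite exprMn [X in X * _ <= _]exprM sqr_sqrtr//; apply: ler_wpM2l.
  by rewrite exprn_ge0.
have aq0 i : 0 <= avg (q i) by rewrite divr_ge0// sumr_ge0.
(* Hoelder's inequality with k + 2 factors from H1 and k factors 1; the root c
   distributes 4 ^ l over the former. *)
have [c c0 cE] : {y : R | 0 <= y & y ^+ k.+2 = 4 ^+ l}.
  by apply: root_exists.
have := @holder_pow R _ xpredT k.+2 k (fun i => Num.sqrt (E2 i))
  (fun i => c * avg (q i)) (fun=> 1) isT.
rewrite (_ : k.+2 + k = 2 * k.+1)%N; last by lia.
move=> HH; apply: le_trans (HH _ _ _ _) _ => {HH}.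
- by move=> i _; exact: sqrtr_ge0.
- by move=> i _; exact: mulr_ge0.
- by [].
- move=> i _; rewrite expr1n mulr1 exprM sqr_sqrtr// [leRHS]exprMn cE.
  exact: H1.
rewrite -[X in X ^+ k.+2 * _]mulr_sumr [X in X * _ <= _]exprMn cE.
rewrite sumr_const card_ffun !card_ord expnM [X in _ <= _ * X * _]natrX.
rewrite [leLHS]mulrAC ler_wpM2l ?mulr_ge0 ?exprn_ge0//.
have T0 : 0 < #|{ffun 'I_n -> 'I_N}|%:R :> R.
  by rewrite card_ffun !card_ord ltr0n expn_gt0 N0.
have M0 : 0 <= (2 ^+ k * G) ^+ (2 * k.+1).
  by rewrite exprM exprn_ge0// sqr_ge0.
have [Q Q0 QE] := root_exists (ltn0Sn k.+1) M0.
rewrite -QE; apply: lerXn2r; rewrite ?nnegrE ?sumr_ge0//.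
rewrite /avg -mulr_suml exchange_big/= ler_pdivrMr// mulr_natr -sumr_const.
apply: ler_sum => e _.
rewrite -(@ler_pXn2r _ k.+2)// ?nnegrE ?sumr_ge0// QE.
apply: blei_at (q0^~ e) (qE^~ e) => a.
by rewrite /torus_point cnX w1 expr1n.
Qed.

End Bound.
End CoefficientSum.

(** * The symmetric tensor of a polynomial *)

Section Bridge.
Variable R : realType.
Local Notation C := (complex R).
Variable n : nat.
Implicit Types p : mpoly n C.

Definition mvar (a : 'I_n) : mpoly n C := mpolyX C (mnm1 a).

Definition mindex l (i : {ffun 'I_l -> 'I_n}) : multinom n :=
  \big[@mnm_add n/mnm0]_s mnm1 (i s).

Lemma xmonE l (i : {ffun 'I_l -> 'I_n}) : xmon mvar i = mpolyX C (mindex i).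
Proof. by rewrite /xmon mprodXE. Qed.

Lemma mindexE l (i : {ffun 'I_l -> 'I_n}) a : mindex i a = mtype i a.
Proof.
rewrite /mindex mnm_sumE ffunE /= /letter_count -sum1_card [RHS]big_mkcond.
by apply: eq_bigr => s _; rewrite mnm1E inE; case: eqP.
Qed.

Lemma mindex_surj d (m : multinom n) : mdeg m = d ->
  exists i : {ffun 'I_d -> 'I_n}, mindex i = m.
Proof.
elim: d m => [|d IH] m md.
  have n0 (t : 'I_0) : 'I_n by case: t.
  exists [ffun t => n0 t]; rewrite /mindex big_ord0.
  by apply/esym/eqP; rewrite -mdeg_eq0 md.
have [a ma] : exists a, (0 < m a)%N.
  apply/existsP; apply: contraPT md; rewrite negb_exists => /forallP h.
  rewrite mdegE big1// => a _; have := h a; by case: (m a).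
have [i im] : exists i : {ffun 'I_d -> 'I_n}, mindex i = mnm_sub m (mnm1 a).
  apply: IH; apply: succn_inj; rewrite -md -addn1 -(mdeg1 a) -mdegD.
  congr mdeg; apply/mnmP => b; rewrite mnmDE mnmBE mnm1E subnK//.
  by case: eqP => [<-|//].
exists [ffun t => if unlift ord0 t is Some t' then i t' else a].
rewrite /mindex big_ord_recl ffunE unlift_none.
rewrite (eq_bigr (fun s => mnm1 (i s))) => [|s _]; last by rewrite ffunE liftK.
rewrite -/(mindex i) im; apply/mnmP => b; rewrite mnmDE mnmBE mnm1E subnKC//.
by case: eqP => [<-|//].
Qed.

Variables (k l : nat).
Local Notation I := ({ffun 'I_k -> 'I_n} * {ffun 'I_l -> 'I_n})%type.
(** Words of length k + l are kept as pairs of words, the form in which they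
    come out of the estimate of the coefficients. *)
Definition pindex (x : I) : multinom n := mnm_add (mindex x.1) (mindex x.2).

Lemma pindex_surj (m : multinom n) : mdeg m = (k + l)%N ->
  exists x, pindex x = m.
Proof.
move=> /mindex_surj[i <-].
exists ([ffun t => i (lshift l t)], [ffun t => i (rshift k t)]).
rewrite /pindex /mindex big_split_ord/=.
by congr mnm_add; apply: eq_bigr => s _; rewrite ffunE.
Qed.

Definition mult (m : multinom n) : C := #|[set x | pindex x == m]|%:R.

Lemma mult_neq0 m : mdeg m = (k + l)%N -> mult m != 0.
Proof.
move=> /pindex_surj[x xm]; rewrite pnatr_eq0 -lt0n; apply/card_gt0P.
by exists x; rewrite inE xm.
Qed.

(** The functional on the polynomial algebra that turns the (k+l)-th power
    of the linear form of z into the homogeneous part of p at z; on monomials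
    it gives the entries of the symmetric tensor of that part. *)
Definition tensor p (q : mpoly n C) : C :=
  \sum_(m <- msupp p | mdeg m == (k + l)%N) mcoeff m p / mult m * mcoeff m q.

Definition hpart p (d : nat) (z : 'I_n -> C) : C :=
  \sum_(m <- msupp p | mdeg m == d) mcoeff m p * \prod_a z a ^+ m a.

Lemma tensor_scalar p : scalar (tensor p).
Proof.
move=> c x y; rewrite /tensor mulr_sumr -big_split/=; apply: eq_bigr => m _.
by rewrite mcoeffD mcoeffZ mulrDr mulrCA.
Qed.

Lemma tensor_lform p z : tensor p (lform mvar z ^+ (k + l)) = hpart p (k + l) z.
Proof.
apply: eq_bigr => m /eqP md.
have -> : mcoeff m (lform mvar z ^+ (k + l)) = mult m * \prod_a z a ^+ m a.
  rewrite exprD !lformX big_distrlr/= pair_bigA/= raddf_sum/=.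
  rewrite (bigID (fun x : I => pindex x == m))/= [X in _ + X]big1 ?addr0.
    rewrite (eq_bigr (fun=> \prod_a z a ^+ m a)).
      by rewrite sumr_const -mulr_natl /mult cardsE.
    move=> x /eqP xm; rewrite -scalerAl -scalerAr scalerA mcoeffZ !xmonE -mpolyXD.
    rewrite mcoeffX -/(pindex x) xm eqxx mulr1 !prod_letter_count -big_split/=.
    by apply: eq_bigr => a _; rewrite -xm /pindex mnmDE !mindexE exprD.
  move=> x /negPf xm; rewrite -scalerAl -scalerAr scalerA mcoeffZ !xmonE -mpolyXD.
  by rewrite mcoeffX -/(pindex x) xm mulr0.
by rewrite mulrA divfK// mult_neq0.
Qed.

(** The functional spreads a coefficient evenly over the pairs of words of
    its type, so that nothing is lost in the sum of the moduli. *)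
Lemma tensor_coeffs p :
  \sum_(m <- msupp p | mdeg m == (k + l)%N) cn (mcoeff m p) <=
  \sum_(i : {ffun 'I_k -> 'I_n}) \sum_(j : {ffun 'I_l -> 'I_n})
    cn (tensor p (xmon mvar i * xmon mvar j)).
Proof.
rewrite pair_bigA/=.
pose G (x : I) := cn (tensor p (xmon mvar x.1 * xmon mvar x.2)).
have GE x m : m \in msupp p -> mdeg m = (k + l)%N -> pindex x = m ->
    G x = cn (mcoeff m p / mult m).
  move=> mp md xm; rewrite /G !xmonE -mpolyXD -/(pindex x) xm /tensor.
  rewrite big_mkcond (bigD1_seq m) ?msupp_uniq//= md eqxx mcoeffX eqxx mulr1.
  rewrite big1 ?addr0// => m' m'm; case: ifP => // _.
  by rewrite mcoeffX eq_sym (negPf m'm) mulr0.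
apply: (@le_trans _ _ (\sum_(m <- msupp p | mdeg m == (k + l)%N)
    \sum_(x | pindex x == m) G x)).
  rewrite big_seq_cond [leRHS]big_seq_cond; apply: ler_sum => m /andP[mp /eqP md].
  rewrite (eq_bigr (fun=> cn (mcoeff m p / mult m))) => [|x /eqP xm]; last exact: GE.
  rewrite sumr_const -mulr_natl -(cn_nat R) -cnM.
  rewrite (_ : #|_|%:R = mult m); last by rewrite /mult cardsE.
  by rewrite mulrC divfK// mult_neq0.
under [leLHS]eq_bigr do rewrite big_mkcond/=.
rewrite exchange_big/=; apply: ler_sum => x _.
rewrite -big_mkcondr/= big_mkcond/=.
have [xs|xs] := boolP (pindex x \in msupp p).
  rewrite (bigD1_seq (pindex x)) ?msupp_uniq//= big1 ?addr0.
    by case: ifP => // _; rewrite /G cn_ge0.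
  by move=> m /negPf mx; rewrite [X in _ && X]eq_sym mx andbF.
rewrite big_seq big1 ?cn_ge0// => m mp; case: ifP => // /andP[_ /eqP xm].
by rewrite -xm (negPf xs) in mp.
Qed.

End Bridge.

(** * Wiener's inequality and a criterion for the Bohr radius *)

Section Wiener.
Variable R : realType.
Local Notation C := (complex R).
Variable n : nat.
Implicit Types p : mpoly n C.

Lemma meval_hpart p z N : (msize p <= N)%N ->
  meval z p = \sum_(d < N) hpart p d z.
Proof.
move=> pN; rewrite mevalE /hpart.
under [RHS]eq_bigr do rewrite big_mkcond/=.
rewrite exchange_big/= big_seq [RHS]big_seq; apply: eq_bigr => m mp.
have mN : (mdeg m < N)%N by exact: leq_trans (msize_mdeg_lt mp) pN.
rewrite -big_mkcond/= (big_pred1 (Ordinal mN))//.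
Qed.

Lemma hpart_big p d z : (msize p <= d)%N -> hpart p d z = 0.
Proof.
move=> pd; rewrite /hpart big_seq_cond big1// => m /andP[mp /eqP md].
by have := msize_mdeg_lt mp; rewrite md ltnNge pd.
Qed.

Lemma hpart0 p z : hpart p 0 z = mcoeff mnm0 p.
Proof.
rewrite /hpart (eq_bigl (fun m => m == mnm0)) => [|m]; last exact: mdeg_eq0.
have [ps|ps] := boolP (@mnm0 n \in msupp p).
  rewrite big_mkcond (bigD1_seq mnm0) ?msupp_uniq//= eqxx [X in _ + X]big1 ?addr0.
    by rewrite big1 ?mulr1// => a _; rewrite mnm0E expr0.
  by move=> m /negPf ->.
rewrite big_seq_cond big1.
  by apply/esym/eqP; rewrite mcoeff_eq0.
by move=> m /andP[mp /eqP m0]; rewrite m0 (negPf ps) in mp.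
Qed.

Lemma hpartZ p d t z : hpart p d (fun a => t * z a) = t ^+ d * hpart p d z.
Proof.
rewrite /hpart mulr_sumr; apply: eq_bigr => m /eqP <-.
rewrite mulrCA; congr (_ * _).
rewrite (eq_bigr (fun a => t ^+ m a * z a ^+ m a)) => [|a _]; last exact: exprMn.
by rewrite big_split/= prodrXr -mdegE.
Qed.

(** Takes a bound on forms from the open polydisk to its closure. *)
Lemma le_scaled (x W : R) d : 0 <= x ->
  (forall t, 0 < t -> t < 1 -> t ^+ d.+1 * x <= W) -> x <= W.
Proof.
move=> x0 H; rewrite leNgt; apply/negP => Wx.
have W0 : 0 <= W.
  apply: le_trans (H (2^-1) _ _); rewrite ?mulr_ge0 ?exprn_ge0 ?invr_ge0//.
  by rewrite invf_lt1// ltr1n.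
have xp : 0 < x by exact: le_lt_trans W0 Wx.
pose s := (W + x) / (2 * x).
have s0 : 0 < s by rewrite divr_gt0 ?mulr_gt0// ltr_wpDl.
have s1 : s < 1 by rewrite ltr_pdivrMr ?mulr_gt0//; lra.
have [t t0 ts] := root_exists (ltn0Sn d) (ltW s0).
have tp : 0 < t.
  by rewrite lt0r t0 andbT; apply: contraTneq s0 => t00; rewrite -ts t00 expr0n ltxx.
have t1 : t < 1.
  by rewrite -(@ltr_pXn2r _ d.+1)// ?nnegrE// ts expr1n.
have := H t tp t1; rewrite ts /s invfM mulrA divfK ?gt_eqF//.
by rewrite ler_pdivrMr//; lra.
Qed.

(** Wiener's bound with the constant 2. For |u| = 1 chosen so that u a_0 is
    the modulus of a_0, the function Re (B - u p) is nonnegative on the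
    polydisk, so its d-th Fourier coefficient along a circle is at most
    its mean value. *)
Lemma wiener p (B : R) d (z : 'I_n -> C) :
  (forall z, polydisk n 1 z -> cn (meval z p) <= B) ->
  (forall a, cn (z a) <= 1) ->
  cn (hpart p d.+1 z) <= 2 * (B - cn (mcoeff mnm0 p)).
Proof.
move=> HB z1.
suff H0 (y : 'I_n -> C) : (forall a, cn (y a) < 1) ->
    cn (hpart p d.+1 y) <= 2 * (B - cn (mcoeff mnm0 p)).
  apply: (@le_scaled _ _ d); first exact: cn_ge0.
  move=> t t0 t1; have <- : cn t%:C%C = t by rewrite cn_real gtr0_norm.
  rewrite -cnX -cnM -hpartZ; apply: H0 => a; rewrite cnM cn_real gtr0_norm//.
  have [->|za] := eqVneq (cn (z a)) 0; first by rewrite mulr0.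
  apply: lt_le_trans (z1 a); rewrite gtr_pMl// lt0r za; exact: cn_ge0.
move=> y1.
pose N := ((msize p).+1 + d.+1)%N.
have dN : (d.+1 < N)%N by rewrite /N; lia.
have DN : ((msize p).+1 < N)%N by rewrite /N; lia.
have N0 : (0 < N)%N by [].
have [w pw] := prim_root_exists R N0; have w1 := prim_cn pw.
have wN0 : w != 0 by rewrite -cn_eq0 w1 oner_eq0.
pose c i := hpart p i y.
pose g (j : nat) := \sum_(i < N) w ^+ (j * i) * c i.
have gE j : g j = meval (fun a => w ^+ j * y a) p.
  rewrite (@meval_hpart _ _ N); last by rewrite /N; lia.
  by apply: eq_bigr => i _; rewrite hpartZ exprM.
have gB j : cn (g j) <= B.
  by rewrite gE; apply: HB => a; rewrite cnM cnX w1 expr1n mul1r.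
have [u u1 uc] := phaseE (c 0%N).
pose f j := B%:C%C - u * g j.
have fR j : 0 <= Re (f j).
  have : Re (u * g j) <= B.
    by apply: le_trans (Re_le_cn _) _; rewrite cnM u1 mul1r.
  by rewrite /f; case: (u * g j) => a b /=; rewrite subr_ge0.
have sumf : \sum_(j < N) f j = (N%:R * (B - cn (c 0%N)))%:C%C.
  rewrite /f sumrB sumr_const card_ord -mulr_sumr.
  have := fourier_coef c pw N0.
  rewrite (eq_bigr (fun j : 'I_N => g j)) => [->|j _]; last first.
    by rewrite muln0 expr0 rmorph1 mulr1.
  rewrite mulrCA uc rmorphM rmorph_nat rmorphB/= mulrBr.
  by rewrite [in RHS]mulr_natl.
have key : \sum_(j < N) (f j + conjc (f j)) * conjc (w ^+ (j * d.+1)) =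
    - (u * (N%:R * c d.+1)).
  have E1 : \sum_(j < N) g j * conjc (w ^+ (j * d.+1)) = N%:R * c d.+1.
    exact: fourier_coef.
  (* conjc g contributes the frequency N - (d + 1) = msize p + 1 of g, which
     is beyond the degree. *)
  have E2 : \sum_(j < N) conjc (g j) * conjc (w ^+ (j * d.+1)) = 0.
    have wE (j : 'I_N) : w ^+ (j * d.+1) = conjc (w ^+ (j * (msize p).+1)).
      rewrite conjcX (unit_conj w1); apply: (mulIf (expf_neq0 (j * (msize p).+1) wN0)).
      rewrite exprVn mulVf ?expf_neq0// -exprD -mulnDr addnC -/N mulnC exprM.
      by rewrite (prim_expr_order pw) expr1n.
    under eq_bigr => j _ do rewrite -rmorphM /= wE.
    rewrite -rmorph_sum/= (fourier_coef c pw DN) /c hpart_big//.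
    by rewrite mulr0 rmorph0.
  have E0 : \sum_(j < N) conjc (w ^+ (j * d.+1)) = 0.
    have := root_orth pw N0 dN; rewrite /= muln0 => E.
    by rewrite -[RHS]E; apply: eq_bigr => j _; rewrite muln0 expr0 mul1r.
  have fE (j : 'I_N) : (f j + conjc (f j)) * conjc (w ^+ (j * d.+1)) =
      2 * B%:C%C * conjc (w ^+ (j * d.+1)) -
      u * (g j * conjc (w ^+ (j * d.+1))) -
      conjc u * (conjc (g j) * conjc (w ^+ (j * d.+1))).
    have -> : conjc (f j) = B%:C%C - conjc u * conjc (g j).
      by rewrite /f rmorphB rmorphM /= oppr0.
    by rewrite /f; ring.
  rewrite (eq_bigr _ (fun j _ => fE j)) !sumrB -!mulr_sumr E0 E1 E2.
  by rewrite !mulr0 subr0 sub0r.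
have := congr1 (@Normc.normc R) key; rewrite cnN !cnM u1 mul1r cn_nat => E.
have Np : 0 < N%:R :> R by rewrite ltr0n.
rewrite -/(c d.+1) -(ler_pM2l Np) -E.
apply: le_trans (cn_sum _ _ _) _.
rewrite (eq_bigr (fun j : 'I_N => 2 * Re (f j))) => [|j _]; last first.
  by rewrite cnM cnJ cnX w1 expr1n mulr1 ReJ cn_real ger0_norm// mulr_ge0.
have -> : \sum_(j < N) 2 * Re (f j) = 2 * Re (\sum_(j < N) f j).
  rewrite -mulr_sumr; congr (_ * _).
  by symmetry; apply: (big_morph (fun x : C => Re x)) => [[? ?] [? ?]|].

by rewrite sumf /= /c hpart0 mulrCA.
Qed.

Lemma majorant_le p (z : 'I_n -> C) (r : R) : 0 <= r ->
  (forall a, cn (z a) <= r) ->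
  majorant p z <= cn (mcoeff mnm0 p) + \sum_(d < msize p)
    r ^+ d.+1 * \sum_(m <- msupp p | mdeg m == d.+1) cn (mcoeff m p).
Proof.
move=> r0 zr.
have H : majorant p z <= \sum_(d < (msize p).+1)
    r ^+ d * \sum_(m <- msupp p | mdeg m == d) cn (mcoeff m p).
  under [leRHS]eq_bigr => d _ do rewrite mulr_sumr big_mkcond/=.
  rewrite exchange_big/= /majorant big_seq [leRHS]big_seq; apply: ler_sum => m mp.
  have mN : (mdeg m < (msize p).+1)%N by rewrite ltnS ltnW// msize_mdeg_lt.
  rewrite -big_mkcond/= (big_pred1 (Ordinal mN)) => [|d]; last first.
    by rewrite /= eq_sym -(inj_eq val_inj).
  rewrite /= cnM cn_prod mulrC; apply: ler_wpM2r; first exact: cn_ge0.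
  rewrite mdegE -prodrXr; apply: ler_prod => a _.
  rewrite cnX exprn_ge0 ?cn_ge0//=; apply: lerXn2r; rewrite ?nnegrE ?cn_ge0//.
apply: le_trans H _; rewrite big_ord_recl/= expr0 mul1r lerD2r.
rewrite (eq_bigl (fun m => m == mnm0)) => [|m]; last exact: mdeg_eq0.
rewrite big_mkcond; have [ps|ps] := boolP (@mnm0 n \in msupp p).
  rewrite (bigD1_seq mnm0) ?msupp_uniq//= eqxx big1 ?addr0//.
  by move=> m /negPf ->.
rewrite big_seq big1 ?cn_ge0//.
move=> m mp; case: eqP => // m0.
by rewrite m0 (negPf ps) in mp.
Qed.

(** The homogeneous parts of degree at least 1 are controlled by the gap
    B - |a_0|, so a series of constants with sum at most 1/2 is enough. *)
Lemma bohr_criterion (r : R) (S : nat -> R) : 0 <= r ->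
  (forall p d B, (forall z : 'I_n -> C, (forall a, cn (z a) <= 1) ->
      cn (hpart p d.+1 z) <= B) ->
    r ^+ d.+1 * (\sum_(m <- msupp p | mdeg m == d.+1) cn (mcoeff m p))
      <= S d * B) ->
  (forall D, 2 * \sum_(d < D) S d <= 1) ->
  bohr_inequality n r.
Proof.
move=> r0 HS S1 p.
have real_case (B : R) : (forall z, polydisk n 1 z -> cn (meval z p) <= B) ->
    forall z, polydisk n r z -> majorant p z <= B.
  move=> HB z zr; set a0 := cn (mcoeff mnm0 p).
  have a0B : a0 <= B.
    have := HB (fun=> 0); rewrite (@meval_hpart _ _ (msize p).+1)//.
    rewrite big_ord_recl big1 ?addr0 => [|d _]; last first.
      have -> : (fun=> 0) = (fun a : 'I_n => 0 * (0 : C)).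
        by apply/funext => a; rewrite mul0r.
      by rewrite hpartZ expr0n /= mul0r.
    by rewrite hpart0; apply => a; rewrite cn0.
  apply: le_trans (majorant_le p r0 (fun a => ltW (zr a))) _.
  rewrite -/a0 -lerBrDl.
  apply: (@le_trans _ _ (\sum_(d < msize p) S d * (2 * (B - a0)))).
    by apply: ler_sum => d _; apply: HS => y y1; exact: wiener.
  rewrite -mulr_suml mulrCA mulrA -[leRHS]mul1r.
  by apply: ler_wpM2r; rewrite ?subr_ge0// S1.
set Y := ereal_sup [set (cn (meval z p))%:E | z in polydisk n 1]%classic.
have Y0 : ((cn (meval (fun=> 0) p))%:E <= Y)%E.
  by apply: ereal_sup_ubound; exists (fun=> 0) => // a; rewrite cn0.
move: Y0; case E : Y => [y| |] // Y0; last by rewrite leey.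
apply: ge_ereal_sup => _ [z zr <-]; rewrite lee_fin.
apply: real_case zr => y1 y1r; rewrite -lee_fin -E.
by apply: ereal_sup_ubound; exists y1.
Qed.
End Wiener.

(** * Growth of exponentials and the number of monomials *)

Section Growth.
Variable R : realType.

Lemma expR_ge_pow (x : R) a : 0 <= x -> x ^+ a / a`!%:R <= expR x.
Proof.
case: a => [|a] x0; first by rewrite expr0 fact0 divr1 -[leLHS]expR0 ler_expR.
by apply: le_trans (expR_ge1Dxn a x0); rewrite lerDr.
Qed.

Lemma pow_expR_small K (c eta : R) : 0 < c -> 0 < eta ->
  exists x0, forall x, x0 <= x -> x ^+ K * expR (- (c * x)) <= eta.
Proof.
move=> c0 eta0; set b := (K.+1)`!%:R / (c ^+ K.+1 * eta).
have b0 : 0 < b by rewrite divr_gt0 ?mulr_gt0 ?exprn_gt0// ltr0n fact_gt0.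
exists b => x bx; have x0 : 0 < x by exact: lt_le_trans bx.
rewrite expRN ler_pdivrMr ?expR_gt0//.
have := @expR_ge_pow (c * x) K.+1 (mulr_ge0 (ltW c0) (ltW x0)).
move=> /(ler_wpM2l (ltW eta0)); apply: le_trans.
rewrite mulrA ler_pdivlMr ?ltr0n ?fact_gt0//.
have -> : eta * (c * x) ^+ K.+1 = x ^+ K * (x * (c ^+ K.+1 * eta)).
  by rewrite exprMn [x ^+ K.+1]exprS; ring.
apply: ler_wpM2l; first by rewrite exprn_ge0// ltW.
by rewrite -ler_pdivrMr// mulr_gt0 ?exprn_gt0.
Qed.

Lemma pow_geometric_bounded a (q : R) : 0 < q -> q < 1 ->
  exists2 K, 0 < K & forall m : nat, m%:R ^+ a * q ^+ m <= K.
Proof.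
move=> q0 q1; pose c := - ln q.
have c0 : 0 < c by rewrite oppr_gt0 ln_lt0// q0.
exists (a`!%:R / c ^+ a); first by rewrite divr_gt0 ?exprn_gt0// ltr0n fact_gt0.
move=> m.
have -> : q ^+ m = expR (- (c * m%:R)).
  by rewrite /c mulNr opprK mulrC expRM_natl lnK.
rewrite expRN ler_pdivrMr ?expR_gt0//.
have f0 : (a`!%:R : R) != 0 by rewrite pnatr_eq0 -lt0n fact_gt0.
have ca0 : c ^+ a != 0 by rewrite expf_neq0 ?gt_eqF.
have -> : m%:R ^+ a = a`!%:R / c ^+ a * ((c * m%:R) ^+ a / a`!%:R) :> R.
  by rewrite exprMn; field; rewrite f0 ca0.
apply: ler_wpM2l; first by rewrite divr_ge0 ?exprn_ge0// ltW.
by apply: expR_ge_pow; rewrite mulr_ge0// ltW.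
Qed.

Lemma ln_unbounded (K : R) :
  exists n0 : nat, forall n, (n0 <= n)%N -> (0 < n)%N /\ K <= ln n%:R.
Proof.
exists (Num.trunc (expR K)).+1 => n hn.
have n0 : (0 < n)%N by exact: leq_trans hn.
split=> //; rewrite -[K]expRK ler_ln ?posrE ?expR_gt0 ?ltr0n//.
apply: ltW; apply: lt_le_trans (_ : (Num.trunc (expR K)).+1%:R <= _).
  exact: truncnS_gt.
by rewrite ler_nat.
Qed.

Lemma ln_div_small (delta : R) : 0 < delta ->
  exists n0 : nat, forall n, (n0 <= n)%N -> ln n%:R / n%:R <= delta.
Proof.
move=> d0; have [x0 H] := @pow_expR_small 1 1 delta ltr01 d0.
have [n0 Hn] := ln_unbounded x0; exists n0 => n /Hn[np xn].
by have := H _ xn; rewrite expr1 mul1r expRN lnK ?posrE ?ltr0n.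
Qed.
End Growth.

Section MultiIndexCount.
Variable R : realType.

(** Generating function of the number of monomials of degree l. *)
Lemma nb_monomials_le n l (y : R) : 0 < y -> y < 1 ->
  (nb_monomials n l)%:R * y ^+ l <= ((1 - y)^-1) ^+ n.
Proof.
move=> y0 y1; have y1' : 0 < 1 - y by rewrite subr_gt0.
apply: (@le_trans _ _ (\sum_(g : {ffun 'I_n -> 'I_l.+1}) \prod_a y ^+ g a)).
  rewrite /nb_monomials -sumr_const mulr_suml big_mkcond /=.
  apply: ler_sum => g _; rewrite inE; case: ifP => [/eqP gl|_].
    by rewrite mul1r prodrXr -/(wdeg g) gl.
  by rewrite prodr_ge0// => a _; rewrite exprn_ge0 ?ltW.
rewrite -(bigA_distr_bigA (fun (a : 'I_n) (j : 'I_l.+1) => y ^+ j)) prodr_const card_ord.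
apply: lerXn2r; rewrite ?nnegrE ?sumr_ge0 ?invr_ge0 ?(ltW y1')//.
  by move=> j _; rewrite exprn_ge0 ?ltW.
rewrite -[leRHS]mul1r ler_pdivlMr// mulrC -[X in X * _]opprB mulNr -subrX1.
by rewrite opprB gerBl exprn_ge0 ?ltW.
Qed.

End MultiIndexCount.

(** * Geometric decay of the homogeneous terms *)

Section LowerBound.
Variable R : realType.
Local Notation C := (complex R).

Definition degree_sum n (p : mpoly n C) d : R :=
  \sum_(m <- msupp p | mdeg m == d) cn (mcoeff m p).

Lemma degree_sum_ge0 n (p : mpoly n C) d : 0 <= degree_sum p d.
Proof. by apply: sumr_ge0 => m _; exact: cn_ge0. Qed.

Lemma degree_bound n (p : mpoly n C) (B tau : R) k l :
  0 <= tau -> tau ^+ k.+1 = 4 ->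
  (forall z : 'I_n -> C, (forall a, cn (z a) <= 1) ->
     cn (hpart p (k.+1 + l) z) <= B) ->
  degree_sum p (k.+1 + l) ^+ 2 <= (nb_monomials n l)%:R * tau ^+ l * n%:R ^+ k *
    (2 ^+ k * (expR 2 * (k.+1 + l)%:R ^+ k.+1 * B)) ^+ 2.
Proof.
move=> t0 t4 HB.
have B0 : 0 <= B.
  by apply: le_trans (HB (fun=> 0) _) => [|a]; rewrite ?cn_ge0 ?cn0.
have bd : bounded_on_polydisk (@mvar R n) (tensor k.+1 l p) (k.+1 + l) B.
  by move=> z z1; rewrite tensor_lform; exact: HB.
have cs := coefficient_sum (tensor_scalar k.+1 l p) bd.
rewrite -(@ler_pXn2r _ k.+1)// ?nnegrE ?mulr_ge0 ?exprn_ge0 ?sqr_ge0 ?degree_sum_ge0//.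
rewrite -[leLHS]exprM; set M := 2 ^+ k * _ in cs *; clearbody M.
have -> : ((nb_monomials n l)%:R * tau ^+ l * n%:R ^+ k * M ^+ 2) ^+ k.+1 =
   (nb_monomials n l)%:R ^+ k.+1 * (4 ^+ l * (n ^ (k.+1 * k))%:R * M ^+ (2 * k.+1)).
  rewrite !exprMn exprAC t4 natrX -!exprM [(k * _)%N]mulnC.
  by rewrite !mulrA -[LHS]mulrA -exprD addnn -mul2n.
apply: le_trans cs; apply: lerXn2r; last exact: tensor_coeffs.
  by rewrite nnegrE degree_sum_ge0.
by rewrite nnegrE sumr_ge0// => i _; rewrite sumr_ge0// => j _; exact: cn_ge0.
Qed.

(** With y = s Lam / n in the count of monomials, every factor n cancels
    except one, and for s < 1 the factor (1 - y) ^ (-n), close to n ^ s, does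
    not make up for it. *)
Lemma term_bound n (p : mpoly n C) (B tau r rho s Lam : R) k l :
  (0 < n)%N -> 0 < s -> 0 < Lam -> s * Lam / n%:R < 1 ->
  r ^+ 2 = rho ^+ 2 * Lam / n%:R ->
  0 <= tau -> tau ^+ k.+1 = 4 ->
  (forall z : 'I_n -> C, (forall a, cn (z a) <= 1) ->
     cn (hpart p (k.+1 + l) z) <= B) ->
  (r ^+ (k.+1 + l) * degree_sum p (k.+1 + l)) ^+ 2 <=
  Lam ^+ k.+1 / n%:R * ((1 - s * Lam / n%:R)^-1) ^+ n *
  ((rho ^+ 2) ^+ (k.+1 + l) * (tau / s) ^+ l *
   (2 ^+ k * (expR 2 * (k.+1 + l)%:R ^+ k.+1)) ^+ 2) * B ^+ 2.
Proof.
move=> n0 s0 L0 y1 rE t0 t4 HB.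
have N0 : 0 < n%:R :> R by rewrite ltr0n.
set y := s * Lam / n%:R in y1 *; have y0 : 0 < y by rewrite divr_gt0 ?mulr_gt0.
have H := degree_bound t0 t4 HB; have Hn := nb_monomials_le n l y0 y1.
have rr : (r ^+ (k.+1 + l)) ^+ 2 = (rho ^+ 2 * Lam / n%:R) ^+ (k.+1 + l).
  by rewrite -exprM mulnC exprM rE.
rewrite [leLHS]exprMn rr.
apply: le_trans (ler_wpM2l _ H) _.
  by rewrite exprn_ge0// divr_ge0// mulr_ge0 ?sqr_ge0 ?(ltW L0).
set W := ((1 - y)^-1) ^+ n in Hn *.
set D := 2 ^+ k * (expR 2 * (k.+1 + l)%:R ^+ k.+1).
have -> : 2 ^+ k * (expR 2 * (k.+1 + l)%:R ^+ k.+1 * B) = D * B.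
  by rewrite /D !mulrA.
have -> : (rho ^+ 2 * Lam / n%:R) ^+ (k.+1 + l) *
   ((nb_monomials n l)%:R * tau ^+ l * n%:R ^+ k * (D * B) ^+ 2) =
   (nb_monomials n l)%:R * y ^+ l * (Lam ^+ k.+1 / n%:R *
   ((rho ^+ 2) ^+ (k.+1 + l) * (tau / s) ^+ l * D ^+ 2) * B ^+ 2).
  rewrite /y !expr_div_n !exprMn [Lam ^+ (_ + _)]exprD [n%:R ^+ (_ + _)]exprD.
  rewrite [n%:R ^+ k.+1]exprS; field.
  by rewrite !expf_neq0 ?gt_eqF//.
apply: le_trans (ler_wpM2r _ Hn) _; last first.
  by rewrite le_eqVlt; apply/orP; left; apply/eqP; ring.
have r20 : 0 <= (rho ^+ 2) ^+ (k.+1 + l) by rewrite exprn_ge0// sqr_ge0.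
have ts0 : 0 <= (tau / s) ^+ l by rewrite exprn_ge0// divr_ge0// ltW.
have LN0 : 0 <= Lam ^+ k.+1 / n%:R by rewrite divr_ge0// exprn_ge0// ltW.
by apply: mulr_ge0 (sqr_ge0 _); apply: mulr_ge0 => //; apply: mulr_ge0 (sqr_ge0 _);
  exact: mulr_ge0.
Qed.

(** k is chosen such that 4^(1/(k+1)) does not spoil the ratio; the degrees
    up to k are finite in number and use the case k = 0. *)
Lemma geometric_terms (rho s q : R) :
  0 < rho -> 0 < s -> s <= 1 -> rho ^+ 2 < s -> rho ^+ 2 / s < q -> q < 1 ->
  exists K : nat, exists2 c : R, 0 < c &
  forall n (p : mpoly n C) (B r Lam : R) d,
  (0 < n)%N -> 1 <= Lam -> s * Lam / n%:R < 1 ->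
  r ^+ 2 = rho ^+ 2 * Lam / n%:R ->
  (forall z : 'I_n -> C, (forall a, cn (z a) <= 1) -> cn (hpart p d.+1 z) <= B) ->
  (r ^+ d.+1 * degree_sum p d.+1) ^+ 2 <=
  Lam ^+ K / n%:R * ((1 - s * Lam / n%:R)^-1) ^+ n * (c * q ^+ d.+1) * B ^+ 2.
Proof.
move=> rho0 s0 s1 rs rsq q1.
have q0 : 0 < q by apply: lt_trans rsq; rewrite divr_gt0 ?exprn_gt0.
have r20 : 0 < rho ^+ 2 by rewrite exprn_gt0.
have [k [tau [t1 t4 tq]]] : exists k : nat, exists tau : R,
    [/\ 1 <= tau, tau ^+ k.+1 = 4 & rho ^+ 2 * tau / s < q].
  pose x := q * s / rho ^+ 2.
  have x1 : 1 < x by rewrite /x ltr_pdivlMr// mul1r -ltr_pdivrMr.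
  have lx : 0 < ln x by exact: ln_gt0.
  have [k kx] : exists k, 4 < x ^+ k.+1.
    exists (Num.trunc (4 / ln x)); set k := Num.trunc _.
    have -> : x ^+ k.+1 = expR (k.+1%:R * ln x).
      by rewrite expRM_natl lnK// posrE (lt_trans ltr01).
    have : 4 < k.+1%:R * ln x by rewrite -ltr_pdivrMr// truncnS_gt.
    by have := expR_ge1Dx (k.+1%:R * ln x); lra.
  have [tau t0 t4] := @root_exists R k.+1 4 isT ltac:(lra).
  exists k, tau; split => //.
    rewrite -(@ler_pXn2r _ k.+1)// ?nnegrE// expr1n t4; lra.
  rewrite mulrAC [ltLHS]mulrC -ltr_pdivlMr; last by rewrite divr_gt0.
  have -> : q / (rho ^+ 2 / s) = x by rewrite /x; field; rewrite ?gt_eqF.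
  rewrite -(@ltr_pXn2r _ k.+1)// ?nnegrE ?t4// ltW// (lt_trans ltr01)//.
(* The ratio q leaves room for q2 to absorb the powers of the degree. *)
pose q2 := rho ^+ 2 * tau / s / q.
have q20 : 0 < q2 by rewrite !divr_gt0 ?mulr_gt0// (lt_le_trans ltr01).
have q21 : q2 < 1 by rewrite ltr_pdivrMr// mul1r.
have [c1 c10 Hc1] := pow_geometric_bounded (k.+1 * 2) q20 q21.
pose c2 := (2 ^+ k * expR 2) ^+ 2 * c1.
pose c3 := (4 / s) ^+ k * (expR 2 * k%:R ^+ 1) ^+ 2 / q ^+ k.
have c20 : 0 <= c2 by rewrite mulr_ge0 ?sqr_ge0// ltW.
have s4 : 1 <= 4 / s by rewrite ler_pdivlMr// mul1r; lra.
have c30 : 0 <= c3.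
  apply: divr_ge0; last by rewrite exprn_ge0// ltW.
  by apply: mulr_ge0 (sqr_ge0 _); rewrite exprn_ge0// (le_trans ler01).
exists k.+1, (1 + c2 + c3); first by lra.
move=> n p B r Lam d n0 L1 y1 rE HB.
have L0 : 0 < Lam by exact: lt_le_trans L1.
have t0 : 0 <= tau by exact: le_trans t1.
have W0 : 0 <= ((1 - s * Lam / n%:R)^-1) ^+ n.
  by rewrite exprn_ge0// invr_ge0 subr_ge0 ltW.
have [kd|dk] := leqP k d.
  have dE : d.+1 = (k.+1 + (d - k))%N by rewrite addSn subnKC.
  rewrite dE in HB *; apply: le_trans (term_bound n0 s0 L0 y1 rE t0 t4 HB) _.
  rewrite -dE; apply: ler_wpM2r; first exact: sqr_ge0.
  apply: ler_wpM2l.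
    by rewrite !mulr_ge0// ?invr_ge0// exprn_ge0// ltW.
  apply: (@le_trans _ _ (c2 * q ^+ d.+1)); last first.
    by apply: ler_wpM2r; [rewrite exprn_ge0// ltW|lra].
  apply: (@le_trans _ _ ((rho ^+ 2) ^+ d.+1 * (tau / s) ^+ d.+1 *
     (2 ^+ k * (expR 2 * d.+1%:R ^+ k.+1)) ^+ 2)).
    apply: ler_wpM2r; first exact: sqr_ge0.
    apply: ler_wpM2l; first by rewrite exprn_ge0// ltW.
    apply: ler_weXn2l; first by rewrite ler_pdivlMr// mul1r (le_trans s1).
    exact: leq_trans (leq_subr _ _) (leqnSn d).
  have -> : (rho ^+ 2) ^+ d.+1 * (tau / s) ^+ d.+1 *
     (2 ^+ k * (expR 2 * d.+1%:R ^+ k.+1)) ^+ 2 =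
     (2 ^+ k * expR 2) ^+ 2 * (d.+1%:R ^+ (k.+1 * 2) * q2 ^+ d.+1) * q ^+ d.+1.
    have e1 : (rho ^+ 2) ^+ d.+1 * (tau / s) ^+ d.+1 = q2 ^+ d.+1 * q ^+ d.+1.
      by rewrite -!exprMn; congr (_ ^+ _); rewrite /q2 divfK ?gt_eqF// mulrA.
    rewrite e1 exprM; set X := d.+1%:R ^+ k.+1; set Y := 2 ^+ k.
    by move: (q2 ^+ _) (q ^+ _) (expR 2) => u v e; ring.
  by apply: ler_wpM2r; [rewrite exprn_ge0// ltW|rewrite /c2 ler_wpM2l ?sqr_ge0].
have H := @term_bound n p B 4 r rho s Lam 0 d n0 s0 L0 y1 rE ltac:(lra) (expr1 _) HB.
apply: le_trans H _; apply: ler_wpM2r; first exact: sqr_ge0.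
rewrite !expr1 expr0 mul1r add1n.
set E0 := (rho ^+ 2) ^+ d.+1 * _ * _.
have E00 : 0 <= E0.
  apply: mulr_ge0 (sqr_ge0 _); apply: mulr_ge0; rewrite exprn_ge0// ?ltW//.
  exact: lt_le_trans s4.
have E0c : E0 <= (1 + c2 + c3) * q ^+ d.+1.
  apply: (@le_trans _ _ (c3 * q ^+ d.+1)); last first.
    by apply: ler_wpM2r; [rewrite exprn_ge0// ltW|lra].
  apply: (@le_trans _ _ ((4 / s) ^+ k * (expR 2 * k%:R ^+ 1) ^+ 2)); last first.
    rewrite /c3 -mulrA ler_peMr//.
      by apply: mulr_ge0 (sqr_ge0 _); rewrite exprn_ge0// (le_trans ler01).
    rewrite mulrC ler_pdivlMr ?exprn_gt0// mul1r.
    by apply: ler_wiXn2l => //; exact: ltW.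
  apply: ler_pM; rewrite ?sqr_ge0//.
  - by rewrite mulr_ge0// exprn_ge0 ?(ltW r20)// (le_trans ler01).
  - rewrite -[leRHS]mul1r; apply: ler_pM.
    + by rewrite exprn_ge0// ltW.
    + by rewrite exprn_ge0// (le_trans ler01).
    + by rewrite exprn_ile1 ?(ltW r20)// ltW// (lt_le_trans rs).
    + by apply: ler_weXn2l => //; exact: ltnW.
  - apply: lerXn2r; rewrite ?nnegrE ?mulr_ge0 ?expR_ge0//.
    by apply: ler_wpM2l; rewrite ?expR_ge0// expr1 ler_nat.
apply: ler_pM => //.
  by apply: mulr_ge0 => //; rewrite divr_ge0// ltW.
apply: ler_wpM2r => //; apply: ler_wpM2r; first by rewrite invr_ge0.
by rewrite -[leLHS]expr1; apply: ler_weXn2l.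
Qed.

End LowerBound.

(** * The lower bound *)

Section LowerTheorem.
Variable R : realType.
Local Notation C := (complex R).

(** For h between s and 1, the factor (1 - y) ^ (-n) is eventually at most
    n ^ (s / h), with an exponent smaller than 1. *)
Lemma count_factor_small K (s eta : R) : 0 < s -> s < 1 -> 0 < eta ->
  exists n0 : nat, forall n, (n0 <= n)%N ->
  [/\ (0 < n)%N, 1 <= ln (n%:R : R), s * ln n%:R / n%:R < 1 &
    ln n%:R ^+ K / n%:R * ((1 - s * ln n%:R / n%:R)^-1) ^+ n <= eta].
Proof.
move=> s0 s1 eta0.
pose h := (1 + s) / 2; have h0 : 0 < h by rewrite /h; lra.
have sh : s < h by rewrite /h; lra.
have h1 : h < 1 by rewrite /h; lra.
have c0 : 0 < 1 - s / h by rewrite subr_gt0 ltr_pdivrMr// mul1r.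
have [x0 Hx] := @pow_expR_small R K (1 - s / h) eta c0 eta0.
have [n1 H1] := ln_unbounded (Num.max 1 x0).
have [n2 H2] := @ln_div_small R (1 - h) ltac:(lra).
exists (maxn n1 n2) => n; rewrite geq_max => /andP[/H1[n0 Hl] /H2 Hd].
have [L1 Lx] : 1 <= ln (n%:R : R) /\ x0 <= ln (n%:R : R).
  by move: Hl; rewrite ge_max => /andP.
set Lam := ln n%:R in Hd L1 Lx *.
have N0 : 0 < n%:R :> R by rewrite ltr0n.
have L0 : 0 < Lam by exact: lt_le_trans L1.
set y := s * Lam / n%:R.
have y0 : 0 < y by rewrite divr_gt0 ?mulr_gt0.
have yh : y <= 1 - h.
  apply: le_trans Hd; rewrite /y -mulrA ler_piMl ?(ltW s1)//.
  by rewrite divr_ge0// ltW.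
have hy : h <= 1 - y by lra.
have y1 : 0 < 1 - y by exact: lt_le_trans hy.
split => //; first by lra.
have W : ((1 - y)^-1) ^+ n <= expR (s / h * Lam).
  have -> : s / h * Lam = n%:R * (y / h).
    by rewrite /y; field; rewrite !gt_eqF.
  rewrite expRM_natl; apply: lerXn2r; rewrite ?nnegrE ?invr_ge0 ?expR_ge0 ?(ltW y1)//.
  apply: le_trans (expR_ge1Dx _).
  rewrite -[leLHS]mul1r ler_pdivrMr//.
  have -> : (1 + y / h) * (1 - y) = 1 + y * ((1 - y) / h - 1).
    by field; rewrite gt_eqF.
  rewrite lerDl mulr_ge0 ?(ltW y0)// subr_ge0 ler_pdivlMr// mul1r//.
apply: le_trans (Hx _ Lx).
have -> : Lam ^+ K / n%:R = Lam ^+ K * expR (- Lam).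
  by rewrite expRN lnK.
rewrite -mulrA; apply: ler_wpM2l; first by rewrite exprn_ge0// ltW.
have -> : - ((1 - s / h) * Lam) = - Lam + s / h * Lam by ring.
by rewrite expRD; apply: ler_wpM2l W; exact: expR_ge0.
Qed.

Theorem bohr_lower (rho : R) : 0 < rho -> rho < 1 ->
  exists n0 : nat, forall n, (n0 <= n)%N ->
  bohr_inequality n (rho * Num.sqrt (ln n%:R / n%:R)).
Proof.
move=> rho0 rho1.
have r20 : 0 < rho ^+ 2 by rewrite exprn_gt0.
have r21 : rho ^+ 2 < 1 by rewrite expr_lt1// ltW.
pose s := (1 + rho ^+ 2) / 2.
have s0 : 0 < s by rewrite /s; lra.
have s1 : s < 1 by rewrite /s; lra.
have rs : rho ^+ 2 < s by rewrite /s; lra.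
have rs1 : rho ^+ 2 / s < 1 by rewrite ltr_pdivrMr// mul1r.
have rs0 : 0 < rho ^+ 2 / s by rewrite divr_gt0.
pose q := (1 + rho ^+ 2 / s) / 2.
have q0 : 0 < q by rewrite /q; lra.
have q1 : q < 1 by rewrite /q; lra.
have [K [c c0 Hc]] := @geometric_terms R rho s q rho0 s0 (ltW s1) rs ltac:(rewrite /q; lra) q1.
have [th th0 thq] := @root_exists R 2 q isT (ltW q0).
have th1 : th < 1 by rewrite -(@ltr_pXn2r _ 2)// ?nnegrE// thq expr1n.
pose a := (1 - th) / 2; have a0 : 0 < a by rewrite /a; lra.
have eta0 : 0 < a ^+ 2 / c by rewrite divr_gt0 ?exprn_gt0.
have [n0 Hn] := @count_factor_small K s _ s0 s1 eta0.
exists n0 => n /Hn[np L1 y1 HW].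
set Lam := ln (n%:R : R) in L1 y1 HW *.
have LN : 0 <= Lam / n%:R by rewrite divr_ge0// (le_trans ler01).
set r := rho * Num.sqrt _.
have r0 : 0 <= r by rewrite mulr_ge0 ?sqrtr_ge0// ltW.
have rE : r ^+ 2 = rho ^+ 2 * Lam / n%:R by rewrite exprMn sqr_sqrtr// mulrA.
apply: (@bohr_criterion R n r (fun d => a * th ^+ d.+1)) => //.
  move=> p d B HB.
  have B0 : 0 <= B.
    by apply: le_trans (HB (fun=> 0) _) => [|i]; rewrite ?cn_ge0 ?cn0.
  have T0 := degree_sum_ge0 p d.+1.
  have := Hc n p B r Lam d np L1 y1 rE HB.
  rewrite -/(degree_sum p d.+1) => H.
  rewrite -(@ler_pXn2r _ 2)// ?nnegrE; last 2 first.
  - by rewrite mulr_ge0// exprn_ge0.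
  - by apply: mulr_ge0 B0; apply: mulr_ge0; rewrite ?exprn_ge0// ltW.
  apply: le_trans H _.
  have -> : (a * th ^+ d.+1 * B) ^+ 2 = a ^+ 2 / c * (c * q ^+ d.+1) * B ^+ 2.
    have e : (th ^+ d.+1) ^+ 2 = q ^+ d.+1 by rewrite exprAC thq.
    have aux (x y z : R) : y != 0 -> x / y * (y * z) = x * z.
      by move=> y0; rewrite mulrA divfK.
    rewrite aux ?gt_eqF//.
    by rewrite [LHS]exprMn [X in X * _ = _]exprMn e.
  apply: ler_wpM2r; first exact: sqr_ge0.
  by apply: ler_wpM2r HW; rewrite mulr_ge0 ?exprn_ge0 ?(ltW q0)// ltW.
move=> D; rewrite -mulr_sumr mulrA.
have -> : 2 * a = 1 - th by rewrite /a; field.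
have -> : \sum_(d < D) th ^+ d.+1 = th * \sum_(d < D) th ^+ d.
  by rewrite mulr_sumr; apply: eq_bigr => d _; rewrite exprS.
rewrite mulrCA -[1 - th]opprB mulNr -subrX1 opprB.
have h1 : th ^+ D <= 1 by rewrite exprn_ile1// ltW.
have h0 : 0 <= th ^+ D by rewrite exprn_ge0.
by rewrite mulr_ile1// ?(ltW th1)//; lra.
Qed.
End LowerTheorem.

(** * Random signs *)

Section Signs.
Variable R : realType.
Local Notation C := (complex R).

(** For 0 <= x <= 1/2 the exponentials are at most 1 / (1 - x) and
    1 / (1 + x); for larger x, already x <= 2 x^2. Any constant in the
    exponent is good enough, as it disappears in an m-th root. *)
Lemma cosh_le (x : R) : expR x + expR (- x) <= 2 * expR (2 * x ^+ 2).
Proof.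
wlog x0 : x / 0 <= x.
  move=> H; have [/H//|x0] := lerP 0 x.
  by have := H (- x); rewrite opprK sqrrN addrC; apply; lra.
have u0 : 0 <= x ^+ 2 by exact: sqr_ge0.
have [xh|xh] := lerP x (2^-1).
  have u4 : x ^+ 2 <= 2^-1.
    rewrite expr2; apply: (@le_trans _ _ (2^-1 * 1)); last by rewrite mulr1.
    apply: ler_pM => //; lra.
  have e1 : expR x <= (1 - x)^-1.
    rewrite -[leLHS]opprK [X in X <= _]opprK -[X in expR X]opprK expRN lef_pV2 ?posrE ?expR_gt0//.
      exact: expR_ge1Dx.
    lra.
  have e2 : expR (- x) <= (1 + x)^-1.
    rewrite expRN lef_pV2 ?posrE ?expR_gt0//; last lra.
    exact: expR_ge1Dx.
  have e3 := expR_ge1Dx (2 * x ^+ 2).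
  have e4 : (1 - x)^-1 + (1 + x)^-1 = 2 / (1 - x ^+ 2).
    by field; apply/andP; split; [|apply/andP; split]; lra.
  have e5 : 2 / (1 - x ^+ 2) <= 2 * (1 + 2 * x ^+ 2).
    rewrite ler_pdivrMr; last lra.
    by move: (x ^+ 2) u0 u4 => u u0 u4; nra.
  lra.
have e1 : expR x <= expR (2 * x ^+ 2) by rewrite ler_expR expr2; nra.
have e2 : expR (- x) <= expR (2 * x ^+ 2) by rewrite ler_expR; lra.
lra.
Qed.

Definition sgn (b : bool) : R := (-1) ^+ b.

(** For independent signs the mean of exp (lam f_t) is a product of
    hyperbolic cosines. Some choice of signs has a sum over t at most the
    mean of that sum, which bounds every f_t. *)
Lemma good_signs (T G : finType) (x : T -> G -> R) (a : G -> R) (lam : R) :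
  (0 < #|T|)%N -> 0 < lam -> (forall t g, `|x t g| <= a g) ->
  exists eps : {ffun G -> bool}, forall t,
    \sum_g sgn (eps g) * x t g <=
    ln #|T|%:R / lam + 2 * lam * \sum_g a g ^+ 2.
Proof.
move=> T0 l0 xa; set s2 := \sum_g a g ^+ 2.
pose Z (eps : {ffun G -> bool}) t := expR (lam * \sum_g sgn (eps g) * x t g).
have [eps He] : exists eps : {ffun G -> bool},
    \sum_t Z eps t <= #|T|%:R * expR (2 * lam ^+ 2 * s2).
  apply/existsP; rewrite -[X in is_true X]negbK negb_exists; apply/negP => /forallP H.
  have : \sum_(eps : {ffun G -> bool}) #|T|%:R * expR (2 * lam ^+ 2 * s2) <
      \sum_(eps : {ffun G -> bool}) \sum_t Z eps t.
    apply: ltr_sum; first by apply/hasP; exists [ffun=> true] => //; rewrite mem_index_enum.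
    by move=> eps _; have := H eps; rewrite -ltNge.
  apply/negP; rewrite -leNgt exchange_big/= sumr_const card_ffun card_bool.
  have -> : (#|T|%:R * expR (2 * lam ^+ 2 * s2)) *+ (2 ^ #|G|) =
      \sum_(t : T) (2 ^ #|G|)%:R * expR (2 * lam ^+ 2 * s2).
    by rewrite sumr_const -[RHS]mulr_natl -[LHS]mulr_natl mulrCA.
  apply: ler_sum => t _.
  have -> : \sum_(eps : {ffun G -> bool}) Z eps t =
      \prod_g \sum_(b : bool) expR (lam * sgn b * x t g).
    rewrite bigA_distr_bigA; apply: eq_bigr => eps _.
    rewrite /Z mulr_sumr (big_morph _ (@expRD R) (expR0 R)).
    by apply: eq_bigr => g _; rewrite mulrA.
  have -> : (2 ^ #|G|)%:R * expR (2 * lam ^+ 2 * s2) =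
      \prod_g (2 * expR (2 * (lam * a g) ^+ 2)).
    rewrite big_split/= prodr_const natrX; congr (_ * _).
    rewrite -(big_morph _ (@expRD R) (expR0 R)); congr expR.
    rewrite /s2 mulr_sumr; apply: eq_bigr => g _.
    by ring.
  apply: ler_prod => g _; rewrite big_bool/= /sgn expr1 expr0 mulrN1 mulNr mulr1.
  rewrite addr_ge0 ?expR_ge0//= addrC; apply: le_trans (cosh_le _) _.
  rewrite ler_pM2l// ler_expR ler_pM2l// !exprMn ler_pM2l ?exprn_gt0//.
  rewrite -[leLHS]real_normK ?num_real//; apply: lerXn2r; rewrite ?nnegrE//.
  exact: le_trans (xa t g).
exists eps => t.
have : Z eps t <= #|T|%:R * expR (2 * lam ^+ 2 * s2).
  apply: le_trans He; rewrite (bigD1 t)//= lerDl sumr_ge0// => ? _.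
  exact: expR_ge0.
have Tp : 0 < #|T|%:R :> R by rewrite ltr0n.
rewrite -ler_ln ?posrE ?expR_gt0 ?mulr_gt0 ?expR_gt0//.
rewrite expRK lnM ?posrE ?expR_gt0// expRK => H.
rewrite -(ler_pM2l l0); apply: le_trans H _.
rewrite le_eqVlt; apply/orP; left; apply/eqP; field.
by rewrite gt_eqF.
Qed.

Lemma prod_diff m (x y : 'I_m -> C) (delta : R) : 0 <= delta ->
  (forall s, cn (x s) <= 1) -> (forall s, cn (y s) <= 1) ->
  (forall s, cn (x s - y s) <= delta) ->
  cn (\prod_s x s - \prod_s y s) <= m%:R * delta.
Proof.
move=> d0; elim: m x y => [|m IH] x y x1 y1 xy.
  by rewrite !big_ord0 subrr cn0 mul0r.
rewrite !big_ord_recl.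
set X := \prod_(i < m) x _; set Y := \prod_(i < m) y _.
have -> : x ord0 * X - y ord0 * Y = (x ord0 - y ord0) * X + y ord0 * (X - Y).
  by ring.
apply: le_trans (cnD _ _) _; rewrite !cnM -natr1 mulrDl mul1r addrC.
apply: lerD.
  rewrite -[leRHS]mul1r; apply: ler_pM; rewrite ?cn_ge0//.
  exact: IH.
rewrite -[leRHS]mulr1; apply: ler_pM; rewrite ?cn_ge0//.
rewrite cn_prod; apply: (@le_trans _ _ (\prod_(i < m) 1)); last by rewrite big1.
by apply: ler_prod => i _; rewrite cn_ge0 x1.
Qed.

(** Words of the same type differ by a permutation of the positions. *)
Lemma type_class_card n m (g : {ffun 'I_n -> 'I_m.+1}) :
  (#|[set i : {ffun 'I_m -> 'I_n} | mtype i == g]| <= m`!)%N.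
Proof.
have [->|[i0 i0g]] := set_0Vmem [set i : {ffun 'I_m -> 'I_n} | mtype i == g].
  by rewrite cards0.
rewrite inE in i0g.
pose h (s : {perm 'I_m}) : {ffun 'I_m -> 'I_n} := [ffun t => i0 (s t)].
apply: (@leq_trans #|h @: [set: {perm 'I_m}]|); last first.
  apply: leq_trans (leq_imset_card _ _) _.
  by rewrite cardsT card_Sn.
apply: subset_leq_card; apply/fintype.subsetP => i; rewrite inE => /eqP ig.
pose ti := [tuple i t | t < m]; pose t0 := [tuple i0 t | t < m].
have count_tuple (j : {ffun 'I_m -> 'I_n}) a : count_mem a [tuple j t | t < m] = letter_count j a.
  rewrite /letter_count /= count_map -size_filter enumT cardE /enum_mem.
  by congr size; apply: eq_filter.
have /tuple_permP[s sE] : perm_eq ti t0.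
  apply/allP => a _ /=; rewrite !count_tuple; apply/eqP.
  have := congr1 (fun f : {ffun 'I_n -> 'I_m.+1} => nat_of_ord (f a)) (etrans ig (esym (eqP i0g))).
  by rewrite !ffunE.
apply/imsetP; exists s => //; apply/ffunP => t; rewrite ffunE.
have := congr1 (fun u : seq _ => nth (i t) u t) sE.
by rewrite -!tnth_nth !tnth_mktuple.
Qed.

End Signs.

(** * A polynomial with small supremum *)

Section SignedPolynomial.
Variable R : realType.
Local Notation C := (complex R).

Definition signed_form n m (eps : {ffun {ffun 'I_n -> 'I_m.+1} -> bool})
    (z : 'I_n -> C) : C :=
  \sum_(i : {ffun 'I_m -> 'I_n}) (sgn R (eps (mtype i)))%:C%C * \prod_s z (i s).

Definition grid_index M : finType := (bool * 'I_M.+1 * (bool * 'I_M.+1))%type.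

(** The grid points outside the closed disk are replaced by 0, so that every
    index gives an admissible test. *)
Definition grid_point M (k : grid_index M) : C :=
  let v := Complex (sgn R k.1.1 * (k.1.2%:R / M%:R))
                   (sgn R k.2.1 * (k.2.2%:R / M%:R)) in
  if cn v <= 1 then v else 0.

Lemma grid_point_le M (k : grid_index M) : cn (grid_point k) <= 1.
Proof. by rewrite /grid_point; case: ifP => //; rewrite cn0. Qed.

Lemma real_grid M (x : R) : (0 < M)%N -> `|x| <= 1 ->
  exists b (k : 'I_M.+1), `|sgn R b * (k%:R / M%:R)| <= `|x| /\
     `|x - sgn R b * (k%:R / M%:R)| <= M%:R^-1.
Proof.
move=> M0 x1; have Mp : 0 < M%:R :> R by rewrite ltr0n.
pose k := Num.trunc (M%:R * `|x|).
have k1 : k%:R <= M%:R * `|x| by rewrite truncn_le mulr_ge0// ltW.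
have k2 : M%:R * `|x| < k.+1%:R by exact: truncnS_gt.
have kM : (k < M.+1)%N.
  by rewrite ltnS -(ler_nat R); apply: le_trans k1 _; rewrite ler_piMr// ltW.
exists (x < 0), (Ordinal kM) => /=.
have kx : k%:R / M%:R <= `|x| by rewrite ler_pdivrMr// mulrC.
have kx' : `|x| <= k%:R / M%:R + M%:R^-1.
  by rewrite -[X in _ + X]mul1r -mulrDl natr1 ler_pdivlMr// mulrC ltW.
have y0 : 0 <= k%:R / M%:R :> R by rewrite divr_ge0.
move: kx kx' y0; set y := k%:R / M%:R.
move: y (M%:R^-1) => y e kx kx' y0.
have [x0|x0] := ltrP x 0; rewrite /sgn ?expr1 ?expr0 ?mulN1r ?mul1r ?normrN ?opprK.
  rewrite (ltr0_norm x0) in kx kx' *; rewrite ger0_norm//; split => //.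
  by rewrite ler0_norm; lra.
rewrite (ger0_norm x0) in kx kx' *; rewrite ger0_norm//; split => //.
by rewrite ger0_norm; lra.
Qed.

Lemma grid_approx M (z : C) : (0 < M)%N -> cn z <= 1 ->
  exists k : grid_index M, cn (z - grid_point k) <= 2 / M%:R.
Proof.
case: z => x y M0 z1.
have le_cn (u v : R) : `|u| <= cn (Complex u v) /\ `|v| <= cn (Complex u v).
  rewrite /= -[`|u|]sqrtr_sqr -[`|v|]sqrtr_sqr.
  by split; apply: ler_wsqrtr; rewrite ?lerDl ?lerDr ?sqr_ge0.
have [xz yz] := le_cn x y.
have [b1 [k1 [h1 e1]]] := real_grid M0 (le_trans xz z1).
have [b2 [k2 [h2 e2]]] := real_grid M0 (le_trans yz z1).
exists ((b1, k1), (b2, k2)); rewrite /grid_point /=.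
set u := sgn R b1 * _ in h1 e1 *; set v := sgn R b2 * _ in h2 e2 *.
have -> : Num.sqrt (u ^+ 2 + v ^+ 2) <= 1.
  apply: le_trans z1; apply: ler_wsqrtr; apply: lerD;
  by rewrite -[leLHS]real_normK ?num_real// -[leRHS]real_normK ?num_real//;
    apply: lerXn2r; rewrite ?nnegrE.
apply: le_trans (cn_le_ReIm _) _; rewrite /=.
by have -> : 2 / M%:R = M%:R^-1 + M%:R^-1 :> R; [ring|exact: lerD].
Qed.

Section Sup.
Variables (n m M : nat).
Hypothesis (M0 : (0 < M)%N).
Local Notation G := {ffun 'I_n -> 'I_m.+1}.

Definition type_class (g : G) : R :=
  #|[set i : {ffun 'I_m -> 'I_n} | mtype i == g]|%:R.

(** The sizes of the classes add up to n ^ m and none exceeds m!. *)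
Lemma type_class_sqr : \sum_g type_class g ^+ 2 <= m`!%:R * (n ^ m)%:R.
Proof.
have -> : (n ^ m)%:R = \sum_g type_class g.
  rewrite /type_class -natr_sum; congr (_%:R).
  rewrite -[in LHS](card_ord n) -[in LHS](card_ord m) -card_ffun.
  rewrite -[LHS]sum1_card (partition_big (@mtype n m) xpredT)//=.
  by apply: eq_bigr => g _; rewrite -sum1_card; apply: eq_bigl => i; rewrite inE.
rewrite mulr_sumr; apply: ler_sum => g _; rewrite expr2.
by apply: ler_wpM2r => //; rewrite ler_nat type_class_card.
Qed.

Lemma signed_formE (eps : {ffun G -> bool}) z :
  signed_form eps z = \sum_g (sgn R (eps g) * type_class g)%:C%C *
     \prod_a z a ^+ g a.
Proof.
rewrite /signed_form (partition_big (@mtype n m) xpredT)//=.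
apply: eq_bigr => g _.
rewrite (eq_bigr (fun=> (sgn R (eps g))%:C%C * \prod_a z a ^+ g a)).
  rewrite sumr_const -mulr_natl rmorphM/= rmorph_nat mulrA; congr (_ * _).
  by rewrite mulrC /type_class cardsE.
by move=> i /eqP <-; rewrite prod_letter_count.
Qed.

Local Notation T := ({ffun 'I_n -> grid_index M} * (bool * bool))%type.

Definition part (c : bool) (z : C) : R := if c then Re z else Im z.

Lemma part_sum (c : bool) (I : finType) (F : I -> C) :
  part c (\sum_i F i) = \sum_i part c (F i).
Proof.
rewrite /part; case: c.
  by apply: (big_morph (fun x : C => Re x)) => [[? ?] [? ?]|].
by apply: (big_morph (fun x : C => Im x)) => [[? ?] [? ?]|].
Qed.

Lemma part_real c (x : R) z : part c (x%:C%C * z) = x * part c z.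
Proof. by case: z => u v; case: c; rewrite /= ?mul0r ?subr0 ?addr0. Qed.

Lemma part_le c z : `|part c z| <= cn z.
Proof.
case: z => u v; case: c; rewrite /= -[leLHS]sqrtr_sqr ler_wsqrtr//.
  by rewrite lerDl sqr_ge0.
by rewrite lerDr sqr_ge0.
Qed.

(** Signs that are good at the points of the grid are good everywhere,
    because a form with n^m terms varies little over a cell of the grid. *)
Lemma small_signed_form (lam : R) : 0 < lam ->
  exists eps : {ffun G -> bool}, forall z : 'I_n -> C,
  (forall a, cn (z a) <= 1) ->
  cn (signed_form eps z) <=
   2 * (ln #|{: T}|%:R / lam + 2 * lam * (m`!%:R * (n ^ m)%:R)) +
   (n ^ m)%:R * (m%:R * (2 / M%:R)).
Proof.
move=> l0.
pose pt (e : {ffun 'I_n -> grid_index M}) a := grid_point (e a).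
pose x (t : T) (g : G) := type_class g * (sgn R t.2.1 *
   part t.2.2 (\prod_a pt t.1 a ^+ g a)).
have T0 : (0 < #|{: T}|)%N.
  by apply/card_gt0P; exists ([ffun=> ((true, ord0), (true, ord0))], (true, true)).
have sgn1 b : `|sgn R b| = 1 by rewrite /sgn normrX normrN1 expr1n.
have xa t g : `|x t g| <= type_class g.
  rewrite /x !normrM sgn1 mul1r ger0_norm// -[leRHS]mulr1.
  apply: ler_wpM2l => //; apply: le_trans (part_le _ _) _.
  rewrite cn_prod; apply: (@le_trans _ _ (\prod_(a < n) 1)); last by rewrite big1.
  apply: ler_prod => a _; rewrite cn_ge0/= cnX exprn_ile1 ?cn_ge0//.
  exact: grid_point_le.
have [eps He] := good_signs T0 l0 xa; exists eps => z z1.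
set tau := ln _ / lam + _.
have {}He t : \sum_g sgn R (eps g) * x t g <= tau.
  apply: le_trans (He t) _; rewrite lerD2l; apply: ler_wpM2l type_class_sqr.
  by rewrite mulr_ge0// ltW.
have pE (e : {ffun 'I_n -> grid_index M}) c :
    `|part c (signed_form eps (pt e))| <= tau.
  have E b : sgn R b * part c (signed_form eps (pt e)) <= tau.
    apply: le_trans (He (e, (b, c))); rewrite signed_formE part_sum mulr_sumr.
    apply: ler_sum => g _; rewrite part_real /x /= le_eqVlt; apply/orP; left.
    by apply/eqP; ring.
  have := E true; have := E false; rewrite /sgn expr0 expr1 mul1r mulN1r.
  by rewrite ler_norml => -> /=; rewrite lerNl => ->.
have [e eE] : exists e : {ffun 'I_n -> grid_index M}, forall a,
    cn (z a - pt e a) <= 2 / M%:R.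
  have K a := cid (grid_approx M0 (z1 a)).
  by exists [ffun a => sval (K a)] => a; rewrite /pt ffunE; case: (K a).
rewrite -[signed_form eps z](subrK (signed_form eps (pt e))) addrC.
apply: le_trans (cnD _ _) _; apply: lerD.
  apply: le_trans (cn_le_ReIm _) _.
  by rewrite mulr_natl mulr2n; apply: lerD; [exact: (pE e true)|exact: (pE e false)].
rewrite /signed_form -sumrB; apply: le_trans (cn_sum _ _ _) _.
rewrite mulr_natl -[in leRHS](card_ord n) -[in X in _ *+ (_ ^ X)](card_ord m) -card_ffun -sumr_const.
apply: ler_sum => i _; rewrite -mulrBr cnM cn_real sgn1 mul1r.
apply: prod_diff => [||s|s]; rewrite ?divr_ge0//.
exact: grid_point_le.
Qed.
End Sup.
End SignedPolynomial.

(** * The upper bound *)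

Section UpperBound.
Variable R : realType.
Local Notation C := (complex R).

(** At a point with all coordinates equal to t r, the majorant of the signed
    form does not see the signs and is (n t r) ^ (d+1). *)
Lemma bohr_signed n d (r W : R) (eps : {ffun {ffun 'I_n -> 'I_d.+2} -> bool}) :
  0 < r -> bohr_inequality n r ->
  (forall z : 'I_n -> C, (forall a, cn (z a) <= 1) ->
     cn (signed_form eps z) <= W) ->
  (n%:R * r) ^+ d.+1 <= W.
Proof.
move=> r0 Hr HW.
pose u (i : {ffun 'I_d.+1 -> 'I_n}) : C := (sgn R (eps (mtype i)))%:C%C.
pose p : mpoly n C := \sum_i u i *: xmon (@mvar R n) i.
have evp z : meval z p = signed_form eps z.
  rewrite /p raddf_sum/=; apply: eq_bigr => i _; rewrite mevalZ xmonE mevalX.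
  by rewrite prod_letter_count; congr (_ * _); apply: eq_bigr => a _; rewrite mindexE.
have coef (i : {ffun 'I_d.+1 -> 'I_n}) : cn (mcoeff (mindex i) p) =
    #|[set j : {ffun 'I_d.+1 -> 'I_n} | mindex j == mindex i]|%:R.
  have -> : mcoeff (mindex i) p = u i * #|[set j : {ffun 'I_d.+1 -> 'I_n} | mindex j == mindex i]|%:R.
    rewrite /p raddf_sum/= (bigID (fun j : {ffun 'I_d.+1 -> 'I_n} => mindex j == mindex i))/=.
    rewrite [X in _ + X]big1 ?addr0 => [|j /negPf ji]; last first.
      by rewrite mcoeffZ xmonE mcoeffX ji mulr0.
    rewrite (eq_bigr (fun=> u i)) => [|j /eqP ji].
      by rewrite sumr_const cardsE mulr_natr.
    rewrite mcoeffZ xmonE mcoeffX ji eqxx mulr1 /u; congr (sgn R (eps _))%:C%C.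
    by apply/ffunP => a; apply: val_inj; rewrite /= -!mindexE ji.
  by rewrite cnM cn_nat /u cn_real /sgn normrX normrN1 expr1n mul1r.
have supp (i : {ffun 'I_d.+1 -> 'I_n}) : mindex i \in msupp p.
  rewrite mcoeff_msupp -cn_eq0 coef pnatr_eq0 -lt0n; apply/card_gt0P.
  by exists i; rewrite inE.
apply: (@le_scaled _ _ _ d); first by rewrite exprn_ge0// mulr_ge0// ltW.
move=> t t0 t1; rewrite -exprMn.
have tr0 : 0 < t * r by rewrite mulr_gt0.
pose z := fun _ : 'I_n => (t * r)%:C%C.
have zr : polydisk n r z.
  by move=> a; rewrite /z cn_real gtr0_norm// gtr_pMl.
apply: (@le_trans _ _ (majorant p z)); last first.
  rewrite -lee_fin.
  apply: (@le_trans _ _ (ereal_sup [set (majorant p z)%:E | z in polydisk n r])%classic).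
    by apply: ereal_sup_ubound; exists z.
  apply: le_trans (Hr p) _; apply: ge_ereal_sup => _ [y y1 <-].
  by rewrite lee_fin evp; apply: HW => a; exact/ltW/y1.
have -> : (t * (n%:R * r)) ^+ d.+1 =
    \sum_(i : {ffun 'I_d.+1 -> 'I_n}) (t * r) ^+ d.+1.
  by rewrite sumr_const card_ffun !card_ord mulrCA exprMn -natrX mulr_natl.
rewrite /majorant.
apply: (@le_trans _ _ (\sum_(m <- msupp p)
    \sum_(i : {ffun 'I_d.+1 -> 'I_n} | mindex i == m) (t * r) ^+ d.+1)).
  under [leRHS]eq_bigr do rewrite big_mkcond/=.
  rewrite exchange_big/=; apply: ler_sum => i _.
  rewrite (bigD1_seq (mindex i)) ?msupp_uniq//= eqxx lerDl.
  by apply: sumr_ge0 => m _; case: ifP => // _; rewrite exprn_ge0// ltW.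
apply: ler_sum => m _.
have [i /eqP im|none] := pickP (fun i : {ffun 'I_d.+1 -> 'I_n} => mindex i == m); last first.
  by rewrite big_pred0 ?cn_ge0.
rewrite -im sumr_const -mulr_natl cnM coef cn_prod cardsE.
apply: ler_wpM2l => //.
rewrite (eq_bigr (fun a => (t * r) ^+ mindex i a)); last first.
  by move=> a _; rewrite cnX /z cn_real gtr0_norm.
rewrite prodrXr (eq_bigr (fun a => nat_of_ord (mtype i a))); last first.
  by move=> a _; rewrite mindexE.
by rewrite -/(wdeg (mtype i)) wdeg_mtype.
Qed.

(** A weak form of Stirling's upper bound; the induction step is
    e <= (1 + 1/(m+1)) ^ (m+2). *)
Lemma fact_le_pow m : (m.+1)`!%:R * expR (m.+1%:R : R) <=
  expR 1 * m.+1%:R ^+ m.+2.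
Proof.
elim: m => [|m IH]; first by rewrite expr1n mulr1 (_ : 1`!%:R = 1) ?mul1r.
rewrite factS natrM -[X in expR X]natr1 expRD.
have -> : m.+2%:R * (m.+1)`!%:R * (expR m.+1%:R * expR 1) =
  m.+2%:R * expR 1 * ((m.+1)`!%:R * expR m.+1%:R) :> R by ring.
apply: le_trans (ler_wpM2l _ IH) _; first by rewrite mulr_ge0// expR_ge0.
have -> : m.+2%:R * expR 1 * (expR 1 * m.+1%:R ^+ m.+2) =
  expR 1 * (m.+2%:R * (expR 1 * m.+1%:R ^+ m.+2)) :> R by ring.
apply: ler_wpM2l; first exact: expR_ge0.
rewrite [leRHS]exprS; apply: ler_wpM2l => //.
have m2 : 0 < m.+2%:R :> R by rewrite ltr0n.
have -> : expR 1 = expR (m.+2%:R^-1) ^+ m.+2 :> R.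
  by rewrite -expRM_natl divff// gt_eqF.
rewrite -exprMn; apply: lerXn2r; rewrite ?nnegrE ?mulr_ge0 ?expR_ge0//.
have := expR_ge1Dx (- (m.+2%:R^-1) : R); rewrite expRN => H.
rewrite mulrC -ler_pdivlMr ?expR_gt0//.
apply: le_trans (ler_wpM2l _ H); last by [].
rewrite mulrBr mulr1 divff ?gt_eqF// -[X in X - 1]natr1 addrK//.
Qed.

Lemma double_succ_le k : (0 < k)%N -> (2 * (2 * k).+1 <= 8 * k)%N.
Proof. lia. Qed.

(** The factor 49 m^2 absorbs the logarithm of the number of tests divided
    by n, which is a polynomial in m and log n. *)
Lemma signed_bound n d (r : R) : (0 < n)%N -> 0 < r ->
  ln (n%:R : R) <= d.+1%:R -> bohr_inequality n r ->
  (n%:R * r) ^+ d.+1 <=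
  49 * d.+1%:R ^+ 2 * Num.sqrt (n%:R * ((d.+1)`!%:R * (n ^ d.+1)%:R)).
Proof.
move=> n0 r0 Lm Hr; set m := d.+1 in Lm *.
have N1 : 1 <= n%:R :> R by rewrite ler1n.
have N0 : 0 < n%:R :> R by rewrite ltr0n.
have m1 : 1 <= m%:R :> R by rewrite ler1n.
set sig : R := m`!%:R * (n ^ m)%:R.
have sig1 : 1 <= sig.
  by rewrite /sig -natrM ler1n muln_gt0 fact_gt0 expn_gt0 n0.
have sig0 : 0 < sig by exact: lt_le_trans sig1.
set Y := Num.sqrt (n%:R * sig).
have Y2 : Y ^+ 2 = n%:R * sig by rewrite sqr_sqrtr// mulr_ge0// ltW.
have Y1 : 1 <= Y.
  rewrite -(@ler_pXn2r _ 2)// ?nnegrE ?sqrtr_ge0// expr1n Y2.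
  by rewrite -[leLHS]mulr1; apply: ler_pM.
have Y0 : 0 < Y by exact: lt_le_trans Y1.
(* This mesh makes the second error term of the grid equal to 1, and the
   choice of lam = n / Y balances the two parts of the first one. *)
pose M := (2 * (m * n ^ m))%N.
have M0 : (0 < M)%N by rewrite /M !muln_gt0 expn_gt0 n0.
have l0 : 0 < n%:R / Y by rewrite divr_gt0.
have [eps He] := @small_signed_form R n m M M0 _ l0.
have H := bohr_signed r0 Hr He.
apply: le_trans H _.
have -> : (n ^ m)%:R * (m%:R * (2 / M%:R)) = 1 :> R.
  rewrite /M natrM natrM; field.
  by rewrite pnatr_eq0 -lt0n expn_gt0 n0 /= gt_eqF// (lt_le_trans ltr01).
have -> : 2 * (n%:R / Y) * (m`!%:R * (n ^ m)%:R) = 2 * Y.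
  rewrite -/sig -mulrA -[_ / _ * _]mulrAC -Y2 expr2 mulfK ?gt_eqF//.
set T := #|_|.
have lnT : ln T%:R <= n%:R * (22 * m%:R ^+ 2) :> R.
  have -> : T = (((2 * M.+1) * (2 * M.+1)) ^ n * (2 * 2))%N.
    by rewrite /T !card_prod card_bool card_ffun !card_prod card_bool !card_ord.
  have A0 : 0 < (2 * M.+1)%:R :> R by rewrite ltr0n.
  rewrite natrM natrX natrM lnM ?posrE ?exprn_gt0 ?mulr_gt0 ?ltr0n//.
  rewrite lnXn ?mulr_gt0// lnM ?posrE//.
  have l4 : ln (2 * 2)%:R < 4 :> R by rewrite ln_sublinear.
  have lA : ln (2 * M.+1)%:R <= 8 * m%:R + m%:R ^+ 2 :> R.
    apply: (@le_trans _ _ (ln ((8 * m)%:R * n%:R ^+ m))).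
      rewrite ler_ln ?posrE ?mulr_gt0 ?exprn_gt0 ?ltr0n// -natrX -natrM ler_nat.
      by rewrite -mulnA; apply: double_succ_le; rewrite muln_gt0 expn_gt0 n0.
    have m80 : 0 < (8 * m)%:R :> R by rewrite ltr0n.
    rewrite lnM ?posrE ?exprn_gt0// lnXn// -[ln n%:R *+ _]mulr_natl; apply: lerD.
      by rewrite -natrM; apply: ltW; exact: ln_sublinear.
    by rewrite expr2; apply: ler_wpM2l.
  rewrite -[_ *+ n]mulr_natl.
  have h1 : n%:R * (ln (2 * M.+1)%:R + ln (2 * M.+1)%:R) <=
      n%:R * (16 * m%:R + 2 * m%:R ^+ 2) :> R.
    by apply: ler_wpM2l => //; lra.
  have h2 : m%:R <= m%:R ^+ 2 :> R by rewrite expr2 ler_peMl.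
  have h3 : 1 <= n%:R * m%:R ^+ 2 :> R.
    by rewrite -[leLHS]mulr1; apply: ler_pM => //; apply: le_trans h2.
  have h4 : n%:R * (16 * m%:R + 2 * m%:R ^+ 2) <= n%:R * (18 * m%:R ^+ 2) :> R.
    by apply: ler_wpM2l => //; lra.
  have h5 : n%:R * (22 * m%:R ^+ 2) = n%:R * (18 * m%:R ^+ 2) + 4 * (n%:R * m%:R ^+ 2) :> R.
    by ring.
  lra.
have lT : ln T%:R / (n%:R / Y) <= 22 * m%:R ^+ 2 * Y :> R.
  rewrite ler_pdivrMr//; apply: le_trans lnT _.
  by rewrite le_eqVlt; apply/orP; left; apply/eqP; field; rewrite gt_eqF.
have m2 : 1 <= m%:R ^+ 2 :> R by rewrite expr2 -[leLHS]mulr1; apply: ler_pM.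
have m2Y : Y <= m%:R ^+ 2 * Y by rewrite ler_peMl// ltW.
have -> : 49 * m%:R ^+ 2 * Y = 44 * m%:R ^+ 2 * Y + 5 * (m%:R ^+ 2 * Y) by ring.
lra.
Qed.

(** For m just above ln n, the exponential in Stirling's bound cancels against
    n = exp (ln n); a radius above the bound would then make (1 + e) ^ m at
    most a constant times m ^ 5. *)
Theorem bohr_upper (e : R) : 0 < e ->
  exists n0 : nat, forall n, (n0 <= n)%N -> forall r, 0 < r ->
  bohr_inequality n r -> r <= (1 + e) * Num.sqrt (ln n%:R / n%:R).
Proof.
move=> e0.
have q0 : 0 < (1 + e)^-1 by rewrite invr_gt0; lra.
have q1 : (1 + e)^-1 < 1 by rewrite invf_lt1; lra.
have [K K0 HK] := pow_geometric_bounded 6 q0 q1.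
pose c : R := 49 ^+ 2 * expR 1.
have c0 : 0 < c by rewrite mulr_gt0 ?expR_gt0// exprn_gt0 ?ltr0n.
have [n0 Hn] := ln_unbounded (1 + K * c + (1 + e) / e).
exists n0 => n /Hn[np]; set Lam := ln (n%:R : R) => HL r r0 Hr.
have N0 : 0 < n%:R :> R by rewrite ltr0n.
have Kc0 : 0 < K * c by exact: mulr_gt0.
have ee0 : 0 < (1 + e) / e by rewrite divr_gt0//; lra.
have [d [Lm mL]] : exists d, Lam <= d.+1%:R /\ d.+1%:R <= Lam + 1.
  exists (Num.trunc Lam); split; first by rewrite ltW// truncnS_gt.
  by rewrite -natr1 lerD2r truncn_le; lra.
pose m := d.+1; rewrite -/m in Lm mL.
have mp : 0 < m%:R :> R by rewrite ltr0n.
rewrite leNgt; apply/negP => rbig.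
have LN : 0 < Lam / n%:R by rewrite divr_gt0//; lra.
have r2 : (1 + e) ^+ 2 * Lam < n%:R * r ^+ 2.
  rewrite -ltr_pdivrMl// mulrC -mulrA.
  have -> : (1 + e) ^+ 2 * (Lam / n%:R) = ((1 + e) * Num.sqrt (Lam / n%:R)) ^+ 2.
    by rewrite exprMn sqr_sqrtr// ltW.
  by rewrite ltr_pXn2r// ?nnegrE ?mulr_ge0 ?sqrtr_ge0 ?(ltW r0)//; lra.
pose x := n%:R * r ^+ 2 / m%:R.
have x0 : 0 < x by rewrite divr_gt0 ?mulr_gt0 ?exprn_gt0.
have xe : 1 + e <= x.
  rewrite ler_pdivlMr//; apply: le_trans (ltW r2).
  rewrite expr2 -mulrA; apply: ler_wpM2l; first lra.
  have : (1 + e) / e <= Lam by lra.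
  rewrite ler_pdivrMr// => h; lra.
have Hx : x ^+ m <= c * m%:R ^+ 5.
  have := signed_bound np r0 Lm Hr; rewrite -/m => H.
  have H2 : (n%:R ^+ 2 * r ^+ 2) ^+ m <=
      49 ^+ 2 * m%:R ^+ 4 * (n%:R * (m`!%:R * n%:R ^+ m)).
    have {H} : ((n%:R * r) ^+ m) ^+ 2 <= (49 * m%:R ^+ 2 *
        Num.sqrt (n%:R * (m`!%:R * (n ^ m)%:R))) ^+ 2.
      apply: lerXn2r H; rewrite nnegrE.
        by rewrite exprn_ge0 ?mulr_ge0 ?(ltW r0).
      by apply: mulr_ge0 (sqrtr_ge0 _); apply: mulr_ge0 => //; exact: exprn_ge0.
    rewrite [X in _ <= X]exprMn sqr_sqrtr; last by rewrite !mulr_ge0.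
    have -> : ((n%:R * r) ^+ m) ^+ 2 = (n%:R ^+ 2 * r ^+ 2) ^+ m.
      by rewrite -exprMn -!exprM mulnC.
    by rewrite natrX [(49 * _) ^+ 2]exprMn -[(m%:R ^+ 2) ^+ 2]exprM.
  have H3 : (n%:R * r ^+ 2) ^+ m <= 49 ^+ 2 * m%:R ^+ 4 * (n%:R * m`!%:R).
    have nm0 : 0 < n%:R ^+ m :> R by rewrite exprn_gt0.
    rewrite -(ler_pM2r nm0) -exprMn.
    have -> : n%:R * r ^+ 2 * n%:R = n%:R ^+ 2 * r ^+ 2 by ring.
    apply: le_trans H2 _; rewrite le_eqVlt; apply/orP; left; apply/eqP.
    by move: (m`!%:R) (n%:R ^+ m) => A0 B0; ring.
  have H4 : n%:R * m`!%:R <= expR 1 * m%:R ^+ m.+1 :> R.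
    apply: le_trans (fact_le_pow d); rewrite mulrC; apply: ler_wpM2l => //.
    by rewrite -[leLHS]lnK ?posrE// ler_expR.
  rewrite /x expr_div_n ler_pdivrMr ?exprn_gt0//.
  apply: le_trans H3 _.
  have -> : c * m%:R ^+ 5 * m%:R ^+ m = 49 ^+ 2 * m%:R ^+ 4 * (expR 1 * m%:R ^+ m.+1).
    rewrite [_ ^+ m.+1]exprS /c; move: (m%:R ^+ m) (expR 1) => u v; ring.
  by apply: ler_wpM2l H4; rewrite mulr_ge0// exprn_ge0.
have Hm : m%:R ^+ 6 <= K * (1 + e) ^+ m.
  have := HK m; rewrite exprVn ler_pdivrMr// exprn_gt0//; lra.
have xm : (1 + e) ^+ m <= x ^+ m.
  by apply: lerXn2r; rewrite ?nnegrE ?(ltW x0)//; lra.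
have m5 : 0 < m%:R ^+ 5 :> R by rewrite exprn_gt0.
have : m%:R * m%:R ^+ 5 <= K * c * m%:R ^+ 5.
  rewrite -exprS; apply: le_trans Hm _; rewrite -mulrA ler_wpM2l ?(ltW K0)//.
  exact: le_trans xm Hx.
rewrite ler_pM2r// => h; lra.
Qed.

End UpperBound.

(** * The limit *)

Local Open Scope classical_set_scope.
Local Open Scope ring_scope.

Section Radius.
Variable R : realType.

(** A point of the open polydisk whose radius is the supremum already lies in
    a polydisk with radius in the set. *)
Lemma bohr_set_sup n : bohr_set R n !=set0 -> has_ubound (bohr_set R n) ->
  bohr_set R n (sup (bohr_set R n)).
Proof.
move=> S0 Su; have [r [r0 Hr]] := S0.
have sr : 0 < sup (bohr_set R n).
  exact: lt_le_trans r0 (ub_le_sup Su (conj r0 Hr)).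
split => // p; apply: ge_ereal_sup => _ [z zs <-].
have mz : \big[Num.max/0]_(i < n) cn (z i) < sup (bohr_set R n).
  by apply: bigmax_lt => // i _; exact: zs.
have [r' [_ Hr'] zr'] := sup_gt S0 mz.
apply: le_trans (Hr' p); apply: ereal_sup_ubound; exists z => // i.
by apply: le_lt_trans zr'; apply: le_bigmax.
Qed.

Lemma bohr_radius_bounds n (a b : R) : 0 < a -> bohr_inequality n a ->
  (forall r, 0 < r -> bohr_inequality n r -> r <= b) ->
  a <= bohr_radius R n <= b.
Proof.
move=> a0 Ha Hb.
have Sa : bohr_set R n a by split.
have Sb : ubound (bohr_set R n) b by move=> r [r0 /Hb]; apply.
have Ssup : bohr_set R n (sup (bohr_set R n)).
  by apply: bohr_set_sup; [exists a|exists b].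
have [Sk Uk] : (bohr_set R n `&` ubound (bohr_set R n)) (bohr_radius R n).
  apply: (@xgetPex _ 0); exists (sup (bohr_set R n)).
  have Usup : ubound (bohr_set R n) (sup (bohr_set R n)).
    by move=> r Sr; apply: ub_le_sup => //; exists b.
  exact: conj Ssup Usup.
by rewrite Uk//= Sb.
Qed.

End Radius.

Theorem mainTheorem1 (R : realType) :
  bohr_radius R n / Num.sqrt (ln (n%:R : R) / n%:R) @[n --> \oo] --> (1 : R).
Proof.
apply/cvgrPdist_le => e0 e00.
pose e := Num.min e0 (2^-1).
have h0 : 0 < 2^-1 :> R by rewrite invr_gt0.
have e_gt0 : 0 < e by rewrite /e lt_min; apply/andP.
have e_le : e <= 2^-1 by rewrite /e ge_min lexx orbT.
have ee0 : e <= e0 by rewrite /e ge_min lexx.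
have [n1 H1] := @bohr_lower R (1 - e) ltac:(lra) ltac:(lra).
have [n2 H2] := bohr_upper e_gt0.
have [n3 H3] := @ln_unbounded R 1.
exists (maxn n1 (maxn n2 n3)) => // n /=.
rewrite !geq_max => /and3P[/H1 lo /H2 up /H3[np L1]].
set s := Num.sqrt _ in lo up *.
have s0 : 0 < s.
  by rewrite sqrtr_gt0 divr_gt0 ?ltr0n// (lt_le_trans ltr01).
have e1 : 0 < 1 - e by lra.
have /andP[k1 k2] := bohr_radius_bounds (mulr_gt0 e1 s0) lo up.
rewrite ler_distlC; apply/andP; split.
  by rewrite ler_pdivlMr//; apply: le_trans k1; rewrite ler_pM2r//; lra.
by rewrite ler_pdivrMr//; apply: le_trans k2 _; rewrite ler_pM2r//; lra.
Qed.
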